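(* Let $\mathfrak{g}$ be a finite-dimensional simple Lie algebra over $\mathbb{C}$, let $k$ be a positive integer, and let $V=L_k(\mathfrak{g})$ be the simple affine vertex operator algebra of level $k$ associated with $\mathfrak{g}$. Then every first-order deformation $Y_1:V\otimes V\to V((x))$ of $V$ is trivial.
   Context: Affine vertex algebras. $\langle\cdot,\cdot\rangle$ is the invariant symmetric bilinear form on $\mathfrak{g}$ normalized so that long roots have squared length $2$. $V^k(\mathfrak{g})$ is the universal affine vertex operator algebra of level $k$: it is generated by the fields $Y(a(-1)\mathbf{1},x)=\sum_{n\in\mathbb{Z}}a(n)x^{-n-1}$, $a\in\mathfrak{g}$, with $[a(m),b(n)]=[a,b](m+n)+m\,\delta_{m+n,0}\langle a,b\rangle k$ and $a(n)\mathbf{1}=0$ for $n\ge 0$, and is linearly spanned by the vectors $a_1(-n_1)\cdots a_r(-n_r)\mathbf{1}$ with $n_i\ge 1$, such a vector having conformal weight $n_1+\cdots+n_r$. $L_k(\mathfrak{g})$ is the simple quotient of $V^k(\mathfrak{g})$ (by the maximal proper graded ideal), with vertex operator $Y$ and vacuum $\mathbf{1}$. Notation. For a vertex algebra $(V,Y,\mathbf{1})$, write $Y(u,x)v=\sum_{n\in\mathbb{Z}}u_n v\,x^{-n-1}$, let $\mathrm{wt}$ denote conformal weight, and let $D:V\to V$, $Dv=v_{-2}\mathbf{1}$ (that is, $D=L(-1)$). $\delta(x)=\sum_{n\in\mathbb{Z}}x^n$, and binomial expressions such as $(x_1-x_2)^n$ are expanded in nonnegative integer powers of the second variable. First-order deformation.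 A first-order deformation of $V$ is a linear map $Y_1:V\otimes V\to V((x))$, $Y_1(u,x)v=\sum_{n\in\mathbb{Z}}u_n^{def}v\,x^{-n-1}$, such that $\mathbb{C}[t]/(t^2)\otimes_{\mathbb{C}}V$ with vertex operator $Y+tY_1$ (extended $\mathbb{C}[t]/(t^2)$-bilinearly) and vacuum $\mathbf{1}$ is a grading-restricted vertex algebra over $\mathbb{C}[t]/(t^2)$. Equivalently: (1) $\mathrm{wt}(u_n^{def}v)=\mathrm{wt}\,u-n-1+\mathrm{wt}\,v$ for homogeneous $u,v\in V$ and $n\in\mathbb{Z}$; (2) $Y_1(\mathbf{1},x)v=0$ and $Y_1(v,x)\mathbf{1}=0$ for all $v\in V$; (3) $[D,Y_1(u,x)]v=Y_1(Du,x)v=\frac{d}{dx}Y_1(u,x)v$ for all $u,v\in V$; (4) for all $u,v\in V$, as operators on $V$, $$x_0^{-1}\delta\left(\tfrac{x_1-x_2}{x_0}\right)\bigl(Y_1(u,x_1)Y(v,x_2)+Y(u,x_1)Y_1(v,x_2)\bigr)-x_0^{-1}\delta\left(\tfrac{-x_2+x_1}{x_0}\right)\bigl(Y_1(v,x_2)Y(u,x_1)+Y(v,x_2)Y_1(u,x_1)\bigr)$$ $$=x_2^{-1}\delta\left(\tfrac{x_1-x_0}{x_2}\right)\bigl(Y_1(Y(u,x_0)v,x_2)+Y(Y_1(u,x_0)v,x_2)\bigr).$$ Trivial deformation. A first-order deformation $Y_1$ is trivial if there is a grading-preserving $\mathbb{C}$-linear map $\phi:V\to V$ with $\phi(\mathbf{1})=0$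 such that $Y_1(u,x)v=Y(\phi(u),x)v-\phi(Y(u,x)v)+Y(u,x)\phi(v)$ for all $u,v\in V$. *)

(* Defs.v *)
From mathcomp Require Export all_boot all_order all_algebra.
From mathcomp Require Export all_classical all_reals.
From mathcomp.real_closed Require Export complex.

Set Implicit Arguments.
Unset Strict Implicit.
Unset Printing Implicit Defensive.

Import Order.TTheory GRing.Theory Num.Theory.
Local Open Scope classical_set_scope.
Local Open Scope ring_scope.

(* R[i] is the field of complex numbers when R : realType. Its order is the
   partial one: x <= y iff y - x is a nonnegative real number. *)

(** * Simple Lie algebras and the normalized form *)

Definition bilinear_map (C : fieldType) (U V W : lmodType C)
    (f : U -> V -> W) : Prop :=
  (forall u, linear (f u)) /\ (forall v, linear (fun u => f u v)).

Record lieAlgebra (C : fieldType) := LieAlgebra {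
  lie_sort :> vectType C;
  lie : lie_sort -> lie_sort -> lie_sort;
  lie_bilinear : bilinear_map lie;
  lie_alternating : forall x, lie x x = 0;
  lie_jacobi : forall x y z,
    lie x (lie y z) + lie y (lie z x) + lie z (lie x y) = 0
}.

Section Lie.
Variables (C : numFieldType) (g : lieAlgebra C).

Definition simple_lie : Prop :=
  (exists x y : g, lie x y <> 0) /\
  forall I : {vspace g},
    (forall x y : g, y \in I -> lie x y \in I) -> I = 0%VS \/ I = fullv.

Definition ad_semisimple (x : g) : Prop :=
  exists2 e : seq g, basis_of fullv e &
    forall v, v \in e -> exists c : C, lie x v = c *: v.

Definition toral (H : {vspace g}) : Prop :=
  (forall x y, x \in H -> y \in H -> lie x y = 0) /\
  (forall x, x \in H -> ad_semisimple x).

(* For a simple Lie algebra over an algebraically closed field of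
   characteristic zero, the Cartan subalgebras are the maximal toral ones. *)
Definition cartan (H : {vspace g}) : Prop :=
  toral H /\
  forall H' : {vspace g}, toral H' -> (H <= H')%VS -> H' = H.

Definition is_root (H : {vspace g}) (alpha : 'Hom(subvs_of H, C^o)) : Prop :=
  alpha != 0 /\
  exists2 x : g, x != 0 &
    forall h : subvs_of H, lie (vsval h) x = (alpha h : C) *: x.

Section Form.
Variable form : g -> g -> C.

(* The squared length of a functional [alpha] on H is <t, t>, where t in H is
   the element that represents [alpha] through the restriction to H of the
   form. *)
Definition sq_length (H : {vspace g}) (alpha : 'Hom(subvs_of H, C^o)) (c : C)
    : Prop :=
  exists2 t : subvs_of H,
    (forall h : subvs_of H, form (vsval t) (vsval h) = alpha h) &
    form (vsval t) (vsval t) = c.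

Definition long_root (H : {vspace g}) (alpha : 'Hom(subvs_of H, C^o)) : Prop :=
  is_root alpha /\
  forall (beta : 'Hom(subvs_of H, C^o)) (c d : C),
    is_root beta -> sq_length alpha c -> sq_length beta d -> d <= c.

Definition invariant_symmetric_form : Prop :=
  [/\ bilinear_map (form : g -> g -> C^o),
      forall x y, form x y = form y x &
      forall x y z, form (lie x y) z = form x (lie y z)].

(* Cartan subalgebras are conjugate, so the normalization does not depend on
   the choice of H. *)
Definition normalized_form : Prop :=
  invariant_symmetric_form /\
  exists2 H : {vspace g}, cartan H &
    (exists alpha : 'Hom(subvs_of H, C^o), long_root alpha) /\
    (forall alpha : 'Hom(subvs_of H, C^o),
       long_root alpha -> sq_length alpha 2).

End Form.
End Lie.

(** * Formal calculus *)

Section FormalCalculus.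
Variables (C : fieldType) (V : lmodType C).

Definition binz (m : int) (i : nat) : C :=
  (\prod_(j < i) (m - j%:Z)%:~R) / (i`!)%:R.

(* A formal series in x and y (resp. in two of the variables x0, x1, x2) is
   given by P : int -> int -> V, where P a b is the coefficient of
   x^(-a-1) y^(-b-1). Each of the following is the coefficient of
   x0^(-l-1) x1^(-m-1) x2^(-n-1) in the product of such a series with a delta
   function, binomials being expanded in nonnegative powers of the second
   variable. The sums over i : nat have finite support as soon as the product
   exists. *)

(* x0^-1 delta((x1 - x2) / x0) P(x1, x2), where
   x0^-1 delta((x1 - x2) / x0) = \sum_l (x1 - x2)^l x0^(-l-1). *)
Definition delta_x1_sub_x2 (P : int -> int -> V) (l m n : int) : V :=
  \sum_(i \in [set: nat])
    ((-1) ^+ i * binz l i) *: P (m + l - i%:Z) (n + i%:Z).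

(* x0^-1 delta((- x2 + x1) / x0) P(x1, x2), where
   x0^-1 delta((- x2 + x1) / x0) = \sum_l (- x2 + x1)^l x0^(-l-1). *)
Definition delta_opp_x2_add_x1 (P : int -> int -> V) (l m n : int) : V :=
  \sum_(i \in [set: nat])
    ((-1) ^ (l - i%:Z) * binz l i) *: P (m + i%:Z) (n + l - i%:Z).

(* x2^-1 delta((x1 - x0) / x2) P(x0, x2), where
   x2^-1 delta((x1 - x0) / x2) = \sum_a (x1 - x0)^a x2^(-a-1); the term
   x1^(a-i) x0^i of (x1 - x0)^a contributes when a = i - m - 1. *)
Definition delta_x1_sub_x0 (P : int -> int -> V) (l m n : int) : V :=
  \sum_(i \in [set: nat])
    ((-1) ^+ i * binz (i%:Z - m - 1) i) *: P (l + i%:Z) (m + n - i%:Z).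

End FormalCalculus.

(** * Grading-restricted vertex algebras *)

Section LinearAlgebra.
Variables (C : fieldType) (V : lmodType C).

Definition subspace (W : set V) : Prop :=
  W 0 /\ forall (a : C) u v, W u -> W v -> W (a *: u + v).

Definition lin_span (S : set V) : set V :=
  [set v | exists2 s : seq (C * V),
     (forall p, p \in s -> S p.2) & v = \sum_(p <- s) p.1 *: p.2].

(* V is the internal direct sum of the subspaces [hom n]. *)
Definition direct_sum_grading (hom : int -> set V) : Prop :=
  (forall n, subspace (hom n)) /\
  forall v, exists! d : int -> V,
    [/\ forall n, hom n (d n), finite_set [set n | d n <> 0] &
        v = \sum_(n \in [set: int]) d n].

(* Y u n v stands for u_n v, so that Y(u, x)v = \sum_n (u_n v) x^(-n-1). *)

Definition lower_truncated (Y : V -> int -> V -> V) : Prop :=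
  forall u v, exists N : int, forall n, N <= n -> Y u n v = 0.

Definition weight_compatible (hom : int -> set V) (Y : V -> int -> V -> V)
    : Prop :=
  forall (p q n : int) u v, hom p u -> hom q v -> hom (p - n - 1 + q) (Y u n v).

(* [D, Y(u, x)] = Y(D u, x) = d/dx Y(u, x) *)
Definition D_derivative (D : V -> V) (Y : V -> int -> V -> V) : Prop :=
  forall u v n,
    D (Y u n v) - Y u n (D v) = Y (D u) n v /\
    Y (D u) n v = (- n)%:~R *: Y u (n - 1) v.

End LinearAlgebra.

Record vertexAlgebra (C : fieldType) := VertexAlgebra {
  va_sort :> lmodType C;
  vac : va_sort;
  Y : va_sort -> int -> va_sort -> va_sort;
  hom : int -> set va_sort;
  va_grading : direct_sum_grading hom;
  va_finite_dim : forall n, exists s : seq va_sort, hom n `<=` lin_span [set` s];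
  va_bounded_below : exists N : int, forall n, n < N -> hom n `<=` [set 0];
  va_bilinear : forall n, bilinear_map (fun u v => Y u n v);
  va_truncated : lower_truncated Y;
  va_vacuum_weight : hom 0 vac;
  va_weight : weight_compatible hom Y;
  va_vacuum : forall n v, Y vac n v = if n == -1 then v else 0;
  va_creation : forall v,
    (forall n, 0 <= n -> Y v n vac = 0) /\ Y v (-1) vac = v;
  va_derivative : D_derivative (fun v => Y v (-2) vac) Y;
  va_jacobi : forall u v w l m n,
    delta_x1_sub_x2 (fun a b => Y u a (Y v b w)) l m n
    - delta_opp_x2_add_x1 (fun a b => Y v b (Y u a w)) l m n
    = delta_x1_sub_x0 (fun a b => Y (Y u a v) b w) l m n
}.

Arguments vac {C} _.
Arguments hom {C} _ _ _.

Definition D (C : fieldType) (V : vertexAlgebra C) (v : V) : V :=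
  Y v (-2) (vac V).

Definition graded_ideal (C : fieldType) (V : vertexAlgebra C) (I : set V)
    : Prop :=
  [/\ subspace I,
      forall u v n, I v -> I (Y u n v) /\ I (Y v n u) &
      I `<=` lin_span [set v | I v /\ exists n, hom V n v]].

Definition proper_graded_ideal (C : fieldType) (V : vertexAlgebra C)
    (I : set V) : Prop :=
  graded_ideal I /\ I <> [set: V].

(* The sum of the proper graded ideals of an affine vertex algebra is proper,
   so its maximal proper graded ideal is the largest one. *)
Definition maximal_proper_graded_ideal (C : fieldType) (V : vertexAlgebra C)
    (I : set V) : Prop :=
  proper_graded_ideal I /\
  forall J : set V, proper_graded_ideal J -> J `<=` I.

Definition va_morphism (C : fieldType) (V W : vertexAlgebra C) (f : V -> W)
    : Prop :=
  [/\ linear f,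
      f (vac V) = vac W,
      forall u n v, f (Y u n v) = Y (f u) n (f v) &
      forall n v, hom V n v -> hom W n (f v)].

(* [pi] exhibits L as the quotient of V by its maximal proper graded ideal. *)
Definition simple_quotient (C : fieldType) (V L : vertexAlgebra C)
    (pi : V -> L) : Prop :=
  [/\ va_morphism pi, forall w, exists v, pi v = w &
      maximal_proper_graded_ideal [set v | pi v = 0]].

(** * Affine vertex algebras *)

Section Affine.
Variables (C : numFieldType) (g : lieAlgebra C) (form : g -> g -> C).
Variable k : C.

(* [act a n], the action of a(n) = a (x) t^n on M, makes M a module of level k
   over the affine Lie algebra of g. *)
Definition affine_module (M : lmodType C) (act : g -> int -> M -> M) : Prop :=
  (forall n, bilinear_map (fun a w => act a n w)) /\
  forall a b m n w,
    act a m (act b n w) - act b n (act a m w)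
    = act (lie a b) (m + n) w
      + (if m + n == 0 then m%:~R * form a b * k else 0) *: w.

Definition annihilated (M : lmodType C) (act : g -> int -> M -> M) (w : M)
    : Prop :=
  forall a n, 0 <= n -> act a n w = 0.

(* a_1(-n_1) ... a_r(-n_r) w for s = [:: (a_1, n_1); ...; (a_r, n_r)] *)
Definition monomial (M : lmodType C) (act : g -> int -> M -> M) (w : M)
    (s : seq (g * nat)) : M :=
  foldr (fun p v => act p.1 (- p.2%:Z) v) w s.

Definition negative_modes (s : seq (g * nat)) : Prop :=
  all (fun p => (1 <= p.2)%N) s.

Definition modes (V : vertexAlgebra C) (iota : g -> V) (a : g) (n : int)
    (v : V) : V :=
  Y (iota a) n v.

(* V is V^k(g), with iota a = a(-1)1. The last clause says that its vacuum
   module is the universal (induced) one: the vacuum is free among the vectors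
   of modules of level k that are annihilated by all a(n), n >= 0. The map f
   is unique because the monomials span V. *)
Definition universal_affine (V : vertexAlgebra C) (iota : g -> V) : Prop :=
  [/\ affine_module (modes iota) /\ annihilated (modes iota) (vac V),
      forall v, lin_span
        [set w | exists2 s, negative_modes s &
                   w = monomial (modes iota) (vac V) s] v,
      forall s, negative_modes s ->
        hom V (\sum_(p <- s) p.2)%N%:Z (monomial (modes iota) (vac V) s) &
      forall (M : lmodType C) (act : g -> int -> M -> M) (w : M),
        affine_module act -> annihilated act w ->
        exists f : V -> M,
          [/\ linear f, f (vac V) = w &
              forall a n v, f (modes iota a n v) = act a n (f v)]].

(* L is L_k(g). *)
Definition simple_affine (L : vertexAlgebra C) : Prop :=
  exists (V : vertexAlgebra C) (iota : g -> V) (pi : V -> L),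
    [/\ linear iota, universal_affine iota & simple_quotient pi].

End Affine.

(** * First-order deformations *)

Section Deformation.
Variables (C : fieldType) (V : vertexAlgebra C) (Y1 : V -> int -> V -> V).

Definition first_order_deformation : Prop :=
  [/\ (forall n, bilinear_map (fun u v => Y1 u n v)) /\ lower_truncated Y1,
      weight_compatible (hom V) Y1,
      forall v n, Y1 (vac V) n v = 0 /\ Y1 v n (vac V) = 0,
      D_derivative (@D C V) Y1 &
      forall u v w l m n,
        delta_x1_sub_x2
          (fun a b => Y1 u a (Y v b w) + Y u a (Y1 v b w)) l m n
        - delta_opp_x2_add_x1
          (fun a b => Y1 v b (Y u a w) + Y v b (Y1 u a w)) l m n
        = delta_x1_sub_x0
          (fun a b => Y1 (Y u a v) b w + Y (Y1 u a v) b w) l m n].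

Definition trivial_deformation : Prop :=
  exists phi : V -> V,
    [/\ linear phi,
        forall n v, hom V n v -> hom V n (phi v),
        phi (vac V) = 0 &
        forall u n v, Y1 u n v = Y (phi u) n v - phi (Y u n v) + Y u n (phi v)].

End Deformation.

(* Main.v *)
(* Write V for L_k(g). A deformation Y_1 makes W = V[t]/(t^2) a vertex algebra
   with operator Y + t Y_1. On the weight one space g of V, a_0 b deforms by a
   2-cocycle of g with values in g, which is a coboundary by Whitehead's lemma, so
   there is phi : g -> g such that the modes of a + t phi(a) in W represent the
   affine Lie algebra, at a level k + c t for some c. Let e be a root vector of a
   long root. Then ad(e)^2 g = C e, so that e(-1)^(k+1) 1 is singular in V^k(g) and
   vanishes in V; hence e(-1) is locally nilpotent on V, and so on W, and sl_2
   theory for e(-1) and f(1) on the vacuum of W forces c = 0. The universal property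
   of V^k(g) now gives a map V^k(g) -> W of affine modules that lifts the projection
   to V. Its t-part sends the maximal ideal to a graded submodule of V without
   vacuum, which is 0; the map that it induces on V trivializes Y_1. *)

From HB Require Import structures.
Require Import Defs.
From mathcomp Require Import spectral ring zify.

Set Implicit Arguments.
Unset Strict Implicit.
Unset Printing Implicit Defensive.

Import Order.TTheory GRing.Theory Num.Theory.
Import VectorInternalTheory.
Local Open Scope ring_scope.

(** * Jordan decomposition *)

(** The obstacle is the level: replacing k by k + t deforms V^k(g), so only a property of the simple
    quotient, local nilpotency of e(-1), can exclude a non-zero c. Moreover the universal property
    of V^k(g) speaks of levels in C only, so W is treated as the complex space V * V, and c = 0 must
    be known before any map into W exists. On the Lie side everything has to come out of
    [normalized_form], which offers a maximal toral H and a longest root, of squared length 2. The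
    element t representing this root has ad t diagonalizable and [t, e] = 2 e, which is enough to
    make the Killing form non-zero, hence nondegenerate. Nondegeneracy makes derivations inner; this
    keeps semisimple parts of ad z inside ad g and forces H to be its own centralizer. Root strings
    make root lengths real up to a common factor, comparison with the Killing form makes them
    positive, and lengths in the interval from 0 to 2 leave no room for [e, [e, a]] outside C e. The
    Killing form serves again in the Casimir element behind Whitehead's lemma. *)

Lemma mxtraceB (R : pzRingType) n (A B : 'M[R]_n) : \tr (A - B) = \tr A - \tr B.
Proof. by rewrite mxtraceD -scaleN1r mxtraceZ mulN1r. Qed.

Section Matrices.
Variable C : closedFieldType.

(** All eigenvalues vanish, so the characteristic polynomial is a power of X; the trace is minus its
    subleading coefficient. *)
Lemma mxtrace_nilpotent n (A : 'M[C]_n) m : A ^+ m = 0 -> \tr A = 0.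
Proof.
case: n A => [|n] A Am; first by rewrite /mxtrace big_ord0.
have [s Ds] := closed_field_poly_normal (char_poly A).
have szs : size s = n.+1.
  have := size_char_poly A; rewrite Ds (monicP (char_poly_monic A)) scale1r.
  by rewrite size_prod_XsubC => -[].
have s0 z : z \in s -> z = 0.
  move=> zs; have /eigenvalueP[v vA v0] : eigenvalue A z.
    rewrite eigenvalue_root_char Ds (monicP (char_poly_monic A)) scale1r.
    by rewrite root_prod_XsubC.
  have : v *m A ^+ m = z ^+ m *: v.
    elim: m {Am} => [|m IH]; first by rewrite !expr0 mulmx1 scale1r.
    by rewrite exprS -[A * _]/(A *m _) mulmxA vA -scalemxAl IH scalerA exprS.
  rewrite Am mulmx0 => /esym/eqP; rewrite scaler_eq0 (negPf v0) orbF.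
  by rewrite expf_eq0 => /andP[_ /eqP].
have : char_poly A = 'X^(n.+1).
  rewrite Ds (monicP (char_poly_monic A)) scale1r -szs big_seq.
  rewrite (eq_bigr (fun=> 'X)); last by move=> z /s0 ->; rewrite subr0.
  by rewrite -big_seq big_const_seq count_predT iter_mulr_1.
move=> e; have := char_poly_trace A (ltn0Sn n); rewrite e coefXn /=.
rewrite ltn_eqF // => /esym/eqP; by rewrite oppr_eq0 => /eqP.
Qed.

(** Chinese remainder theorem: the correction added for a new root [r] is a multiple of [m], so the
    congruences at the earlier roots survive. *)
Lemma crt_XsubC (F : fieldType) (rs : seq F) N : uniq rs ->
  exists p : {poly F}, forall r, r \in rs -> ('X - r%:P) ^+ N %| p - r%:P.
Proof.
elim: rs => [|r rs IH] /=; first by exists 0.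
move=> /andP[rrs /IH[p pP]].
pose m := \prod_(z <- rs) ('X - z%:P) ^+ N.
have cop : coprimep m (('X - r%:P) ^+ N).
  rewrite coprimep_expr // coprimep_sym.
  rewrite /m big_seq; apply: (big_ind (fun q => coprimep _ q)).
  - exact: coprimep1.
  - by move=> a b; rewrite coprimepMr => -> ->.
  move=> z zrs; rewrite coprimep_expr // coprimep_XsubC root_XsubC.
  by apply: contraNneq rrs => <-.
have [[u v] /= uv] := Bezout_eq1_coprimepP _ _ cop.
exists (p + u * m * (r%:P - p)) => z; rewrite inE => /predU1P[->|zrs].
  have -> : p + u * m * (r%:P - p) - r%:P = (p - r%:P) * (1 - u * m) by ring.
  by rewrite -uv [_ + v * _]addrC addrK mulrA dvdp_mulIr.
rewrite addrAC dvdp_addr ?pP //.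
rewrite dvdp_mulr // dvdp_mull // /m (big_rem z) //=.
exact: dvdp_mulIl.
Qed.

(* S = p(A), where p = r modulo (X - r)^N for each eigenvalue r of A. *)
Lemma Jordan_Chevalley n (A : 'M[C]_n) :
  exists S : 'M[C]_n, [/\ diagonalizable S, exists m, (A - S) ^+ m = 0 &
    forall B, B *m A = A *m B -> B *m S = S *m B].
Proof.
case: n A => [|n] A.
  exists 0; split; [exact: diagonalizable0 | exists 1%N; exact: flatmx0 |].
  by move=> B _; rewrite mulmx0 mul0mx.
have [s Ds] := closed_field_poly_normal (char_poly A).
rewrite (monicP (char_poly_monic A)) scale1r in Ds.
pose rs := undup s; pose N := size s.
have N0 : (0 < N)%N.
  have := size_char_poly A; rewrite Ds size_prod_XsubC -/N => -[->] //.
pose Q : {poly C} := \prod_(r <- rs) ('X - r%:P).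
have chiA : char_poly A %| Q ^+ N.
  have -> : Q ^+ N = \prod_(z <- s) Q.
    by rewrite big_const_seq count_predT iter_mulr_1.
  rewrite Ds big_seq [X in _ %| X]big_seq.
  apply: (big_ind2 (fun a b => a %| b)) => [|a b c d|z zs]; first exact: dvdpp.
    exact: dvdp_mul.
  by rewrite dvdp_XsubCl /Q root_prod_XsubC mem_undup.
have QA : horner_mx A (Q ^+ N) = 0.
  by apply/mxminpoly_minP; exact: dvdp_trans (mxminpoly_dvd_char A) chiA.
have [p pP] := crt_XsubC N (undup_uniq s).
exists (horner_mx A p); split.
- apply/diagonalizableP; exists rs; first exact: undup_uniq.
  apply: mxminpoly_min.
  have -> : horner_mx (horner_mx A p) Q = horner_mx A (\prod_(r <- rs) (p - r%:P)).
    rewrite /Q !rmorph_prod /=; apply: eq_bigr => r _.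
    by rewrite rmorphB /= horner_mx_X horner_mx_C [RHS]rmorphB /= horner_mx_C.
  suff /dvdpP[q ->] : Q ^+ N %| \prod_(r <- rs) (p - r%:P).
    by rewrite rmorphM /= QA mulr0.
  rewrite /Q -prodrXl big_seq [X in _ %| X]big_seq.
  apply: (big_ind2 (fun a b => a %| b)) => [|a b c d|z zs]; first exact: dvdpp.
    exact: dvdp_mul.
  exact: pP.
- exists N; have -> : A - horner_mx A p = horner_mx A ('X - p).
    by rewrite rmorphB /= horner_mx_X.
  rewrite -rmorphXn /=; suff /dvdpP[q ->] : Q ^+ N %| ('X - p) ^+ N.
    by rewrite rmorphM /= QA mulr0.
  apply: dvdp_exp2r; apply: uniq_roots_dvdp; last first.
    by rewrite uniq_rootsE undup_uniq.
  apply/allP => r /pP; rewrite -dvdp_XsubCl => rp.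
  have -> : 'X - p = ('X - r%:P) - (p - r%:P) by ring.
  rewrite dvdp_sub // (dvdp_trans _ rp) // -{1}[_ - _]expr1 dvdp_exp2l //.
- move=> B BA; elim/poly_ind: p {pP} => [|p c IH].
    by rewrite rmorph0 mulmx0 mul0mx.
  rewrite rmorphD rmorphM /= horner_mx_X horner_mx_C mulmxDr mulmxDl.
  rewrite scalar_mxC; congr (_ + _).
  by rewrite -[_ * A]/(_ *m A) mulmxA IH -!mulmxA BA.
Qed.
End Matrices.

Lemma diagonalizable_basis (F : fieldType) n (A : 'M[F]_n) :
  diagonalizable A <->
  exists2 P : 'M_n, P \in unitmx & exists c : 'I_n -> F,
    forall i, row i P *m A = c i *: row i P.
Proof.
split=> [[P Pu /diagonalizable_forPex[d /(simmxP Pu) e]]|[P Pu [c e]]].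
  exists P => //; exists (d 0) => i.
  by rewrite -row_mul e row_mul row_diag_mx -scalemxAl -rowE.
exists P => //; apply/diagonalizable_forPex; exists (\row_i c i).
apply/(simmxP Pu)/row_matrixP => i.
by rewrite !row_mul e row_diag_mx -scalemxAl -rowE mxE.
Qed.


(** * Matrices acting on a vector space, and bases given by the rows of a matrix *)

Section MatrixAction.
Variables (F : fieldType) (U : vectType F).
Notation n := (dim U).
Implicit Types (A B : 'M[F]_n) (v : U).

(** Matrices act on coordinate rows from the right, so in a product the left factor acts first;
    hence the reversed order in [mxactM] and [adm_lie]. *)
Definition mxact A v : U := r2v (v2r v *m A).

Lemma mxact_is_linear A : linear (mxact A).
Proof. by move=> a u v; rewrite /mxact linearP mulmxDl -scalemxAl linearP. Qed.
HB.instance Definition _ A := GRing.isLinear.Build F U U _ (mxact A) (mxact_is_linear A).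

Definition mxof_fun (f : U -> U) : 'M[F]_n := lin1_mx (v2r \o f \o r2v).

Lemma mxof_funK (f : {linear U -> U}) v : mxact (mxof_fun f) v = f v.
Proof. by rewrite /mxact /mxof_fun mul_rV_lin1 /= !v2rK. Qed.

Lemma mxactM A B v : mxact (A *m B) v = mxact B (mxact A v).
Proof. by rewrite /mxact r2vK mulmxA. Qed.

Lemma mxact1 v : mxact 1%:M v = v.
Proof. by rewrite /mxact mulmx1 v2rK. Qed.

Lemma mxactD A B v : mxact (A + B) v = mxact A v + mxact B v.
Proof. by rewrite /mxact mulmxDr linearD. Qed.

Lemma mxactZ c A v : mxact (c *: A) v = c *: mxact A v.
Proof. by rewrite /mxact -scalemxAr linearZ. Qed.

Lemma mxactN A v : mxact (- A) v = - mxact A v.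
Proof. by rewrite /mxact mulmxN linearN. Qed.

Lemma mxact0 v : mxact 0 v = 0.
Proof. by rewrite /mxact mulmx0 linear0. Qed.

Lemma mxactX A m v : mxact (A ^+ m) v = iter m (mxact A) v.
Proof.
elim: m v => [|m IH] v; first by rewrite expr0 mxact1.
by rewrite exprSr -[_ * _]/(_ *m _) mxactM IH.
Qed.

Lemma mxact_inj A B : mxact A =1 mxact B -> A = B.
Proof.
move=> e; apply/row_matrixP => i; rewrite !rowE.
by have := e (r2v (delta_mx 0 i)); rewrite /mxact !r2vK => /r2v_inj.
Qed.

Variable P : 'M[F]_n.
Hypothesis Pu : P \in unitmx.

Definition basvec i : U := r2v (row i P).
Definition bascoord i v : F := (v2r v *m invmx P) 0 i.

Lemma bascoord_is_linear i : linear (bascoord i : U -> F^o).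
Proof.
by move=> a u v; rewrite /bascoord linearP mulmxDl -scalemxAl !mxE.
Qed.
HB.instance Definition _ i :=
  GRing.isLinear.Build F U F^o _ (bascoord i : U -> F^o) (bascoord_is_linear i).

Lemma bascoordZ i a v : bascoord i (a *: v) = a * bascoord i v.
Proof. exact: linearZ. Qed.

Lemma bascoord_sum v : v = \sum_i bascoord i v *: basvec i.
Proof.
apply: v2r_inj; rewrite linear_sum /=.
rewrite -{1}[v2r v](mulmxKV Pu) (mulmx_sum_row _ P).
by apply: eq_bigr => i _; rewrite linearZ /= r2vK.
Qed.

Lemma bascoordE i j : bascoord j (basvec i) = (i == j)%:R.
Proof.
by rewrite /bascoord /basvec r2vK -row_mul mulmxV // !mxE.
Qed.

Lemma bascoord_suml (c : 'I_n -> F) j :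
  bascoord j (\sum_i c i *: basvec i) = c j.
Proof.
rewrite linear_sum (bigD1 j) //= big1 => [|i ij].
  by rewrite bascoordZ bascoordE eqxx addr0 mulr1.
by rewrite bascoordZ bascoordE (negPf ij) mulr0.
Qed.

Lemma basvec_neq0 i : basvec i != 0.
Proof.
apply: contra_eq_neq (bascoordE i i) => ->.
by rewrite eqxx /bascoord linear0 mul0mx mxE eq_sym oner_neq0.
Qed.

Lemma mxtrace_basvec A : \tr A = \sum_i bascoord i (mxact A (basvec i)).
Proof.
have -> : \tr A = \tr (P *m A *m invmx P).
  by rewrite -mulmxA mxtrace_mulC mulmxKV.
apply: eq_bigr => i _; rewrite /bascoord /mxact /basvec !r2vK.
by rewrite -!row_mul [RHS]mxE.
Qed.

Lemma mxact_eq_on_basis A B :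
  (forall i, mxact A (basvec i) = mxact B (basvec i)) -> A = B.
Proof.
move=> e; apply: mxact_inj => v; rewrite [v]bascoord_sum !linear_sum.
by apply: eq_bigr => i _; rewrite !linearZ /= e.
Qed.

Lemma mxact_coord_eigen A c l v i : (forall i, mxact A (basvec i) = c i *: basvec i) ->
  mxact A v = l *: v -> bascoord i v = 0 \/ c i = l.
Proof.
move=> Ac Av.
have : mxact A v = \sum_i (bascoord i v * c i) *: basvec i.
  rewrite [v in LHS]bascoord_sum linear_sum; apply: eq_bigr => j _.
  by rewrite linearZ /= Ac scalerA.
move/(congr1 (bascoord i)); rewrite bascoord_suml Av bascoordZ mulrC => /eqP.
by rewrite -subr_eq0 -mulrBr mulf_eq0 subr_eq0 => /orP[]/eqP; [left | right].
Qed.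

Lemma exists_diag_mxact (d : 'I_n -> F) :
  exists A, forall i, mxact A (basvec i) = d i *: basvec i.
Proof.
exists (invmx P *m diag_mx (\row_i d i) *m P) => i.
rewrite /mxact /basvec r2vK !mulmxA -row_mul mulmxV // row1 -rowE row_diag_mx.
by rewrite -scalemxAl -rowE mxE linearZ.
Qed.

(** An eigenvector for [l] involves only basis vectors with [c i = l], so [f] may be any function;
    it is applied to complex conjugation. *)
Lemma mxact_eigen_fun A B c (f : F -> F) l v :
  (forall i, mxact A (basvec i) = c i *: basvec i) ->
  (forall i, mxact B (basvec i) = f (c i) *: basvec i) ->
  mxact A v = l *: v -> mxact B v = f l *: v.
Proof.
move=> Ac Bc Av; rewrite [v in LHS]bascoord_sum [v in RHS]bascoord_sum.
rewrite linear_sum scaler_sumr; apply: eq_bigr => i _.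
rewrite linearZ /= Bc !scalerA.
by have [->|->] := mxact_coord_eigen i Ac Av; rewrite ?mulr0 ?mul0r // mulrC.
Qed.

Lemma mxtrace_eigenvectors A c :
  (forall i, mxact A (basvec i) = c i *: basvec i) -> \tr A = \sum_i c i.
Proof.
move=> Ac; rewrite mxtrace_basvec; apply: eq_bigr => i _.
by rewrite Ac bascoordZ bascoordE eqxx mulr1.
Qed.

End MatrixAction.

(** * Simple Lie algebras *)

(** A subspace inside [P] is enlarged by one vector at a time, by induction on its codimension. This
    lets simplicity be applied to ideals given by arbitrary predicates. *)
Lemma vspace_of_subspace (F : fieldType) (U : vectType F) (P : U -> Prop) :
  subspace P -> exists W : {vspace U}, forall x, x \in W <-> P x.
Proof.
move=> [P0 PD].
have PA u v : P u -> P v -> P (u + v) by move=> Pu Pv; rewrite -[u]scale1r; exact: PD.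
have PZ a u : P u -> P (a *: u) by move=> Pu; rewrite -[_ *: _]addr0; exact: PD.
suff H k : forall W : {vspace U}, (forall x, x \in W -> P x) ->
    (\dim {:U} - \dim W <= k)%N -> exists W : {vspace U}, forall x, x \in W <-> P x.
  apply: (H _ 0%VS) (leqnn _) => x; rewrite memv0 => /eqP -> //.
elim: k => [|k IH] W WP dW.
  exists W => x; split; first exact: WP.
  suff /eqP -> : W == fullv by rewrite memvf.
  by rewrite -(geq_leqif (dimv_leqif_eq (subvf W))) -subn_eq0 -leqn0.
have [[x [Px xW]]|H] := pselect (exists x, P x /\ x \notin W); last first.
  exists W => x; split; first exact: WP.
  by move=> Px; apply: contrapT => xW; apply: H; exists x; split => //; apply/negP.
apply: (IH (W + <[x]>)%VS).
  by move=> y /memv_addP[u uW [v /vlineP[a ->] ->]]; apply: PA; [exact: WP | exact: PZ].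
have : (\dim W < \dim (W + <[x]>))%N.
  rewrite ltn_neqAle dimvS ?addvSl // andbT.
  apply: contraNneq xW => e.
  have /eqP -> : W == (W + <[x]>)%VS by rewrite eqEdim addvSl /= e.
  by apply: subvP (addvSr _ _) _ _; rewrite memv_line.
move: dW; rewrite !leq_subLR addnS => dW lt.
by apply: leq_trans dW _; rewrite -addSn leq_add2r.
Qed.

Lemma basis_of_rows (F : fieldType) (U : vectType F) (P : 'M[F]_(dim U)) :
  (P \in unitmx) = basis_of {:U}%VS [tuple basvec P i | i < dim U].
Proof.
set X := [tuple _ | _ < _].
have XE (k : 'I_(dim U) -> F) : \sum_i k i *: X`_i = r2v ((\row_i k i) *m P).
  rewrite mulmx_sum_row linear_sum; apply: eq_bigr => i _.
  by rewrite linearZ mxE -tnth_nth tnth_mktuple.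
rewrite basisEfree subvf dimvf size_tuple leqnn !andbT.
rewrite -row_free_unit -kermx_eq0; apply/rowV0P/freeP => [Pf k|Xf v /sub_kermxP vP].
  rewrite XE => k0 i; have : \row_i k i = 0.
    by apply/Pf/sub_kermxP/r2v_inj; rewrite k0 linear0.
  by move/rowP/(_ i); rewrite !mxE.
apply/rowP => i; rewrite mxE; apply: Xf (v 0) _ i.
rewrite XE; have -> : \row_i v 0 i = v by apply/rowP => j; rewrite mxE.
by rewrite vP linear0.
Qed.

Section LieBasics.
Variables (F : fieldType) (g : lieAlgebra F).
Implicit Types (x y z : g) (a : F).

HB.instance Definition _ x :=
  GRing.isLinear.Build F g g _ (@lie F g x) (proj1 (lie_bilinear g) x).

Lemma lieDl x y z : lie (x + y) z = lie x z + lie y z.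
Proof. by have := proj2 (lie_bilinear g) z 1 x y; rewrite /= !scale1r. Qed.

Lemma lieDr x y z : lie x (y + z) = lie x y + lie x z.
Proof. exact: linearD. Qed.

Lemma lie0l z : lie 0 z = 0.
Proof. by apply: (addrI (lie 0 z)); rewrite -lieDl !addr0. Qed.

Lemma lieZl a x z : lie (a *: x) z = a *: lie x z.
Proof. by have := proj2 (lie_bilinear g) z a x 0; rewrite /= !addr0 lie0l addr0. Qed.

Lemma lieZr a x z : lie x (a *: z) = a *: lie x z.
Proof. exact: linearZ. Qed.

Lemma lieNl x z : lie (- x) z = - lie x z.
Proof. by rewrite -scaleN1r lieZl scaleN1r. Qed.

Lemma lieBl x y z : lie (x - y) z = lie x z - lie y z.
Proof. by rewrite lieDl lieNl. Qed.

Lemma lie_suml I (r : seq I) (Q : pred I) (G : I -> g) z :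
  lie (\sum_(i <- r | Q i) G i) z = \sum_(i <- r | Q i) lie (G i) z.
Proof. by apply: (big_morph (fun x => lie x z)); [move=> x y; exact: lieDl | exact: lie0l]. Qed.

Lemma lieC x y : lie x y = - lie y x.
Proof.
apply/eqP; rewrite -addr_eq0; apply/eqP.
by have := lie_alternating (x + y); rewrite lieDl !lieDr !lie_alternating add0r addr0.
Qed.

Lemma lie_derivation x y z : lie x (lie y z) = lie (lie x y) z + lie y (lie x z).
Proof.
have /eqP := lie_jacobi x y z; rewrite -addrA addr_eq0 => /eqP ->.
by rewrite (lieC z x) (lieC z (lie x y)) linearN /= opprD !opprK addrC.
Qed.

Definition adm x : 'M[F]_(dim g) := mxof_fun (lie x).

Lemma admE x v : mxact (adm x) v = lie x v.
Proof. exact: mxof_funK. Qed.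

Lemma adm_lie x y : adm (lie x y) = adm y *m adm x - adm x *m adm y.
Proof.
apply: mxact_inj => v; rewrite mxactD mxactN !mxactM !admE.
by rewrite (lie_derivation x) addrK.
Qed.

Lemma admP a x y : adm (a *: x + y) = a *: adm x + adm y.
Proof. by apply: mxact_inj => v; rewrite mxactD mxactZ !admE lieDl lieZl. Qed.

Lemma admB x y : adm (x - y) = adm x - adm y.
Proof. by apply: mxact_inj => v; rewrite mxactD mxactN !admE lieBl. Qed.

Lemma admD x y : adm (x + y) = adm x + adm y.
Proof. by apply: mxact_inj => v; rewrite mxactD !admE lieDl. Qed.

Lemma adm_comm x y : lie x y = 0 -> adm x *m adm y = adm y *m adm x.
Proof.
move=> xy; have := adm_lie x y; rewrite xy => /eqP.
have -> : adm 0 = 0 by apply: mxact_inj => v; rewrite admE lie0l mxact0.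
by rewrite eq_sym subr_eq0 => /eqP.
Qed.

End LieBasics.

Lemma ad_semisimpleP (F : numFieldType) (g : lieAlgebra F) (x : g) :
  ad_semisimple x <-> diagonalizable (adm x).
Proof.
rewrite diagonalizable_basis; split=> [[e be ev]|[P Pu [c Pc]]].
  have se : size e == dim g.
    by rewrite -dimvf -(size_basis (X := in_tuple e) be).
  pose X : (dim g).-tuple g := Tuple se.
  pose P : 'M[F]_(dim g) := b2mx X.
  have PX i : basvec P i = X`_i by rewrite /basvec b2mxK.
  exists P.
    rewrite basis_of_rows; suff -> : [tuple basvec P i | i < dim g] = X by [].
    by apply: eq_from_tnth => i; rewrite tnth_mktuple PX -tnth_nth.
  have H i : exists c, row i P *m adm x = c *: row i P.
    have [|c xc] := ev X`_i; first by rewrite mem_nth // (eqP se).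
    exists c; apply: r2v_inj; rewrite linearZ /= -[r2v (row i P)]/(basvec P i) PX.
    by rewrite -xc -PX -admE /mxact r2vK.
  by exists (fun i => sval (cid (H i))) => i; case: cid.
exists [tuple basvec P i | i < dim g]; first by rewrite -basis_of_rows.
move=> _ /mapP[i _ ->]; exists (c i).
by rewrite -admE /mxact r2vK Pc linearZ.
Qed.

(** * Invariant forms, the Killing form and derivations *)

Section InvariantForms.
Variables (C : numFieldType) (g : lieAlgebra C) (B : g -> g -> C).
Implicit Types (h x y z : g).
Hypothesis Binv : invariant_symmetric_form B.

Lemma formP a x y z : B (a *: x + y) z = a * B x z + B y z.
Proof. by have [[_ H] _ _] := Binv; exact: H. Qed.

Lemma formC x y : B x y = B y x.
Proof. by have [] := Binv. Qed.

Lemma form_inv x y z : B (lie x y) z = B x (lie y z).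
Proof. by have [] := Binv. Qed.

Lemma form0l z : B 0 z = 0.
Proof. by have /eqP := formP 1 0 0 z; rewrite scale1r mul1r addr0 -subr_eq subrr => /eqP. Qed.

Lemma form0r z : B z 0 = 0.
Proof. by rewrite formC form0l. Qed.

Lemma formZl a x z : B (a *: x) z = a * B x z.
Proof. by rewrite -[a *: x]addr0 formP form0l addr0. Qed.

Lemma formZr a x z : B z (a *: x) = a * B z x.
Proof. by rewrite formC formZl formC. Qed.

Lemma formDl x y z : B (x + y) z = B x z + B y z.
Proof. by have := formP 1 x y z; rewrite scale1r mul1r. Qed.

Lemma formDr x y z : B z (x + y) = B z x + B z y.
Proof. by rewrite formC formDl !(formC z). Qed.

Lemma formNl x z : B (- x) z = - B x z.
Proof. by rewrite -scaleN1r formZl mulN1r. Qed.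

Lemma formBl x y z : B (x - y) z = B x z - B y z.
Proof. by rewrite formDl formNl. Qed.

Lemma formNr x z : B z (- x) = - B z x.
Proof. by rewrite formC formNl formC. Qed.

Lemma form_sumr I (r : seq I) (Q : pred I) (G : I -> g) z :
  B z (\sum_(i <- r | Q i) G i) = \sum_(i <- r | Q i) B z (G i).
Proof. by apply: (big_morph (B z)); [move=> x y; exact: formDr | exact: form0r]. Qed.

Lemma form_ortho_eigen h x y a b : lie h x = a *: x -> lie h y = b *: y ->
  a + b != 0 -> B x y = 0.
Proof.
move=> hx hy ab; apply/eqP; have : (a + b) * B x y = 0.
  by rewrite mulrDl -formZl -hx -formZr -hy (lieC h) formNl form_inv addNr.
by move/eqP; rewrite mulf_eq0 (negPf ab).
Qed.

End InvariantForms.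

Section Killing.
Variables (C : numClosedFieldType) (g : lieAlgebra C).
Hypothesis gs : simple_lie g.
Implicit Types (x y z u v : g) (P : g -> Prop) (B : g -> g -> C).

Lemma simple_ideal P : subspace P -> (forall x y, P y -> P (lie x y)) ->
  (forall x, P x -> x = 0) \/ (forall x, P x).
Proof.
move=> Psub PI; have [W WP] := vspace_of_subspace Psub.
have [|W0|W1] := proj2 gs W; first by move=> x y /WP Py; apply/WP/PI.
  by left=> x /WP; rewrite W0 memv0 => /eqP.
by right=> x; apply/WP; rewrite W1 memvf.
Qed.

Lemma center_eq0 x : (forall y, lie x y = 0) -> x = 0.
Proof.
move=> xC; have [||H|H] := @simple_ideal (fun x => forall y, lie x y = 0).
- split=> [y|a u v uC vC y]; first by rewrite lie0l.
  by rewrite lieDl lieZl uC vC scaler0 addr0.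
- by move=> z y yC w; rewrite (lieC z) yC oppr0 lie0l.
- exact: H.
by have [[u [v []]]] := gs; apply: H.
Qed.

(** This is g = [g, g] as an induction principle: the intersection of all subspaces containing the
    brackets is a non-zero ideal. *)
Lemma bracket_ind P : subspace P -> (forall x y, P (lie x y)) -> forall x, P x.
Proof.
move=> Pl Pb x; have [||H|H] := @simple_ideal
  (fun x => forall P, subspace P -> (forall x y, P (lie x y)) -> P x).
- split=> [Q [] //|a u v Hu Hv Q Ql Qb].
  by case: (Ql) => _; apply; [exact: Hu | exact: Hv].
- by move=> z y _ Q _; apply.
- have [[u [v []]]] := gs; apply: H => Q _; exact.
exact: H.
Qed.

Lemma form_nondegenerate B : invariant_symmetric_form B -> (exists x y, B x y <> 0) ->
  forall x, (forall y, B x y = 0) -> x = 0.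
Proof.
move=> Bi [u [v uv]] x xB.
have [||H|H] := @simple_ideal (fun x => forall y, B x y = 0).
- split=> [y|a y z yB zB w]; first by rewrite (form0l Bi).
  by rewrite (formP Bi) yB zB mulr0 addr0.
- by move=> z y yB w; rewrite lieC (formNl Bi) (form_inv Bi) yB oppr0.
- exact: H.
by case: uv; exact: H.
Qed.


Lemma dim_gt0 : (0 < dim g)%N.
Proof.
have [[u [v uv]] _] := gs; rewrite lt0n; apply: contra_notN uv => /eqP d0.
apply: v2r_inj; rewrite linear0; apply/rowP => i.
by have := ltn_ord i; rewrite {2}d0.
Qed.

Definition stdvec i : g := basvec 1%:M i.

Lemma stdvec_sum v : v = \sum_i v2r v 0 i *: stdvec i.
Proof.
rewrite [LHS](bascoord_sum (unitmx1 _ _)); apply: eq_bigr => i _.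
by rewrite /bascoord invmx1 mulmx1.
Qed.

Definition gram B : 'M[C]_(dim g) := \matrix_(i, j) B (stdvec i) (stdvec j).

Lemma gramE B x i : invariant_symmetric_form B ->
  (v2r x *m gram B) 0 i = B x (stdvec i).
Proof.
move=> Bi; rewrite [x in RHS]stdvec_sum (formC Bi) (form_sumr Bi) mxE.
by apply: eq_bigr => j _; rewrite mxE (formZr Bi) (formC Bi).
Qed.

Lemma form_eq_stdvec B x : invariant_symmetric_form B ->
  (forall i, B x (stdvec i) = 0) -> forall y, B x y = 0.
Proof.
move=> Bi Bx y; rewrite [y]stdvec_sum (form_sumr Bi) big1 // => i _.
by rewrite (formZr Bi) Bx mulr0.
Qed.

Lemma gram_unit B : invariant_symmetric_form B -> (exists x y, B x y <> 0) ->
  gram B \in unitmx.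
Proof.
move=> Bi B0; rewrite -row_free_unit -kermx_eq0; apply/rowV0P => v /sub_kermxP vB.
apply: r2v_inj; rewrite linear0; apply: (form_nondegenerate Bi B0).
apply: form_eq_stdvec => // i.
by rewrite -gramE // r2vK vB mxE.
Qed.

(** Schur's lemma: for an eigenvalue [c] of the Gram matrix of [B'] relative to that of [B], the
    invariant form [B' - c B] is degenerate, hence zero. *)
Lemma form_proportional B B' : invariant_symmetric_form B ->
  (exists x y, B x y <> 0) -> invariant_symmetric_form B' ->
  exists c, forall x y, B' x y = c * B x y.
Proof.
move=> Bi B0 Bi'; have Bu := gram_unit Bi B0.
have [c /eigenvalueP[v vM v0]] := eigenvalue_closed (gram B' *m invmx (gram B)) dim_gt0.
have vE : v *m gram B' = c *: (v *m gram B).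
  by rewrite scalemxAl -vM -!mulmxA mulVmx // mulmx1.
exists c; pose B2 x y : C := B' x y - c * B x y.
have B2i : invariant_symmetric_form B2.
  split=> [|x y|x y z]; last 2 first.
  - by rewrite /B2 (formC Bi) (formC Bi').
  - by rewrite /B2 (form_inv Bi) (form_inv Bi').
  have H y : linear (fun x => B2 x y : C^o).
    move=> a u w; rewrite /B2 (formP Bi) (formP Bi').
    by transitivity (a * (B' u y - c * B u y) + (B' w y - c * B w y)); [ring|].
  split=> // u a x y; rewrite /B2 !(formC Bi u) !(formC Bi' u); exact: H.
have Bx y : B2 (r2v v) y = 0.
  apply: form_eq_stdvec y => // i; rewrite /B2 -!gramE // r2vK vE mxE.
  by rewrite subrr.
have [B20|B20] := pselect (exists x y, B2 x y <> 0).
  have /(congr1 v2r) := form_nondegenerate B2i B20 Bx.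
  by rewrite r2vK linear0 => v00; rewrite v00 eqxx in v0.
move=> x y; apply/eqP; rewrite -subr_eq0; apply/eqP; apply: contrapT => xy.
by apply: B20; exists x, y.
Qed.

Definition killing x y : C := \tr (adm x *m adm y).

Lemma killing_inv : invariant_symmetric_form killing.
Proof.
split=> [|x y|x y z].
- have H y : linear (fun x => killing x y : C^o).
    by move=> a u v; rewrite /killing admP mulmxDl -scalemxAl mxtraceD mxtraceZ.
  split=> // x a u v; rewrite /killing admP mulmxDr -scalemxAr mxtraceD.
  by rewrite mxtraceZ.
- exact: mxtrace_mulC.
rewrite /killing !adm_lie mulmxBl mulmxBr !mxtraceB; congr (_ - _).
  by rewrite -mulmxA mxtrace_mulC mulmxA.
by rewrite mulmxA.
Qed.

Lemma derivation_of_basis (P : 'M[C]_(dim g)) (T : 'M[C]_(dim g)) : P \in unitmx ->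
  (forall i j, mxact T (lie (basvec P i) (basvec P j)) =
    lie (mxact T (basvec P i)) (basvec P j) + lie (basvec P i) (mxact T (basvec P j))) ->
  forall u v, mxact T (lie u v) = lie (mxact T u) v + lie u (mxact T v).
Proof.
move=> Pu H.
have H1 i v : mxact T (lie (basvec P i) v) =
    lie (mxact T (basvec P i)) v + lie (basvec P i) (mxact T v).
  rewrite [v](bascoord_sum Pu) !linear_sum -big_split; apply: eq_bigr => j _.
  by rewrite /= !lieZr !linearZ /= H scalerDr.
move=> u v; rewrite [u](bascoord_sum Pu) linear_sum !lie_suml linear_sum -big_split.
apply: eq_bigr => i _.
by rewrite /= linearZ !lieZl /= linearZ /= H1 scalerDr.
Qed.

(* If the Killing form vanished, so would tr(ad t \o T) for the derivation T
   with eigenvalues conjugate to those of ad t; but this is a sum of squared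
   moduli. *)
Lemma killing_neq0 (t e : g) : ad_semisimple t -> e != 0 -> lie t e = e *+ 2 ->
  exists x y, killing x y <> 0.
Proof.
move=> /ad_semisimpleP/diagonalizable_basis[P Pu [c Pc]] e0 te.
apply: contrapT => K0.
have K x y : killing x y = 0.
  by apply: contrapT => xy; apply: K0; exists x, y.
have tb i : mxact (adm t) (basvec P i) = c i *: basvec P i.
  by rewrite /mxact r2vK Pc linearZ.
have [T Tb] := exists_diag_mxact Pu (fun i => (c i)^*).
have Te l v : lie t v = l *: v -> mxact T v = l^* *: v.
  by rewrite -admE; exact: (mxact_eigen_fun Pu tb Tb).
(* The bracket adds eigenvalues of [ad t], and conjugation is additive, so [T] is a derivation. *)
have Td : forall u v, mxact T (lie u v) = lie (mxact T u) v + lie u (mxact T v).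
  apply: (derivation_of_basis Pu) => i j; rewrite (Te (c i + c j)).
    by rewrite rmorphD /= !Tb lieZl linearZ scalerDl.
  have tl k : lie t (basvec P k) = c k *: basvec P k by rewrite -admE.
  by rewrite lie_derivation !tl lieZl lieZr scalerDl.
(* Since [T, ad y] = ad (T y), the trace of ad [x, y] composed with T is - [killing x (T y)], which
   is zero by assumption; brackets span g. *)
have trT : forall x, \tr (adm x *m T) = 0.
  apply: bracket_ind => [|x y].
    split=> [|a u v uT vT].
      by rewrite -[0](subrr t) admB subrr mul0mx mxtrace0.
    by rewrite admP mulmxDl -scalemxAl mxtraceD mxtraceZ uT vT mulr0 addr0.
  have -> : \tr (adm (lie x y) *m T) = - \tr (adm x *m adm (mxact T y)).
    have -> : adm (mxact T y) = adm y *m T - T *m adm y.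
      apply: mxact_inj => v; rewrite mxactD mxactN !mxactM !admE Td.
      by rewrite addrK.
    rewrite adm_lie mulmxBl mulmxBr !mxtraceB opprB; congr (_ - _).
      by rewrite -mulmxA mxtrace_mulC mulmxA.
    by rewrite mulmxA.
  by rewrite -/(killing _ _) K oppr0.
have : \sum_i `|c i| ^+ 2 = 0.
  rewrite -[RHS](trT t) (mxtrace_eigenvectors Pu (c := fun i => `|c i| ^+ 2)) // => i.
  by rewrite mxactM tb linearZ /= Tb scalerA normCK.
move/eqP; rewrite psumr_eq0 => [/allP c0|i _]; last exact: exprn_ge0.
have ci i : c i = 0.
  by have := c0 i (mem_index_enum i); rewrite /= expf_eq0 normr_eq0 => /eqP.
have t0 : adm t = 0.
  by apply: (mxact_eq_on_basis Pu) => i; rewrite tb ci scale0r mxact0.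
move/eqP: te; rewrite -admE t0 mxact0 eq_sym -scaler_nat scaler_eq0 pnatr_eq0 /=.
by rewrite (negPf e0).
Qed.


Hypothesis K0 : exists x y, killing x y <> 0.

(** Let [d] represent the functional x -> tr(T ad x) through the Killing form. Then E = T - ad d is
    a derivation with tr(E ad x) = 0 for all x, and [killing (E a) b] = tr([E, ad a] ad b) = tr(E ad
    [a, b]) = 0, so E = 0. *)
Lemma inner_derivation (T : 'M[C]_(dim g)) :
  (forall u v, mxact T (lie u v) = lie (mxact T u) v + lie u (mxact T v)) ->
  exists d, T = adm d.
Proof.
move=> Td; have Ku := gram_unit killing_inv K0.
pose r := \row_i \tr (T *m adm (stdvec i)).
pose d : g := r2v (r *m invmx (gram killing)).
have Kd i : killing d (stdvec i) = \tr (T *m adm (stdvec i)).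
  by rewrite -gramE ?r2vK ?mulmxKV ?mxE //; exact: killing_inv.
have [E EE] : exists E, E = T - adm d by exists (T - adm d).
have Ed v : mxact E v = mxact T v - lie d v by rewrite EE mxactD mxactN admE.
have trE x : \tr (E *m adm x) = 0.
  have Kx i : \tr (E *m adm (stdvec i)) = 0.
    by rewrite EE mulmxBl mxtraceB -Kd -/(killing _ _) subrr.
  have tr0 : \tr (E *m adm 0) = 0 by rewrite -[0](subrr 0) admB mulmxBr mxtraceB subrr.
  rewrite [x]stdvec_sum; elim/big_ind: _ => // [u v uE vE|i _].
    by rewrite admD mulmxDr mxtraceD uE vE addr0.
  have := admP (v2r x 0 i) (stdvec i) 0; rewrite addr0 => ->.
  by rewrite mulmxDr -scalemxAr mxtraceD mxtraceZ Kx tr0 mulr0 addr0.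
exists d; apply/eqP; rewrite -subr_eq0 -EE; apply/eqP.
apply: mxact_inj => a; rewrite mxact0.
apply: (form_nondegenerate killing_inv K0) => b.
rewrite /killing; have -> : adm (mxact E a) = adm a *m E - E *m adm a.
  apply: mxact_inj => v; rewrite mxactD mxactN !mxactM !admE !Ed Td linearB /=.
  rewrite lieBl (lie_derivation d); set p := lie a (mxact T v); set q := lie a (lie d v).
  by rewrite opprD opprB [_ + p + _]addrACA -[RHS]addrA (addrA (p - q)) subrK subrr addr0.
rewrite mulmxBl mxtraceB -mulmxA mxtrace_mulC -!mulmxA -mxtraceB -mulmxBr.
by rewrite -adm_lie trE.
Qed.

(** Leibniz rule: ad z - r - s acts on [u, v] as ad z - r on u plus ad z - s on v, lowering [m] or
    [n] by one. *)
Lemma generalized_eigen_lie z k m n r s u v : (m + n <= k)%N ->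
  mxact ((adm z - r%:M) ^+ m) u = 0 -> mxact ((adm z - s%:M) ^+ n) v = 0 ->
  mxact ((adm z - (r + s)%:M) ^+ k) (lie u v) = 0.
Proof.
have N c w : mxact (adm z - c%:M) w = lie z w - c *: w.
  by rewrite mxactD mxactN admE -scalemx1 mxactZ mxact1.
elim: k m n u v => [|k IH] m n u v mn um vn.
  move: mn um; rewrite leqn0 addn_eq0 => /andP[/eqP-> _].
  by rewrite expr0 mxact1 => ->; rewrite lie0l linear0.
case: m mn um => [|m] mn um; first by move: um; rewrite expr0 mxact1 => ->; rewrite lie0l linear0.
case: n mn vn => [|n] mn vn; first by move: vn; rewrite expr0 mxact1 => ->; rewrite !linear0.
rewrite mxactX iterSr -mxactX N lie_derivation.
have -> : lie (lie z u) v + lie u (lie z v) - (r + s) *: lie u v =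
    lie (mxact (adm z - r%:M) u) v + lie u (mxact (adm z - s%:M) v).
  by rewrite !N lieBl lieZl linearB /= lieZr scalerDl opprD addrACA.
rewrite linearD /= (IH m n.+1) ?(IH m.+1 n) ?addr0 //.
- by move: mn; rewrite addnS.
- by rewrite mxactX -iterSr -mxactX.
by rewrite mxactX -iterSr -mxactX.
Qed.

(** The semisimple part of ad z is a scalar on each generalized eigenspace of ad z. As these
    multiply by adding eigenvalues, it is a derivation, hence inner. *)
Lemma semisimple_part z : exists zs, [/\ diagonalizable (adm zs),
  exists m, adm (z - zs) ^+ m = 0,
  forall x, lie z x = 0 -> lie zs x = 0 &
  forall A : 'M_(dim g), A *m adm z = adm z *m A -> A *m adm zs = adm zs *m A].
Proof.
have [S [Sd [m Am] SB]] := Jordan_Chevalley (adm z).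
have [P Pu [c Pc]] := (diagonalizable_basis S).1 Sd.
have Sb i : mxact S (basvec P i) = c i *: basvec P i.
  by rewrite /mxact r2vK Pc linearZ.
have AS := SB _ (erefl (adm z *m adm z)).
have bgen i : mxact ((adm z - (c i)%:M) ^+ m) (basvec P i) = 0.
  suff H k : mxact ((adm z - (c i)%:M) ^+ k) (basvec P i)
      = mxact ((adm z - S) ^+ k) (basvec P i) /\
     mxact S (mxact ((adm z - S) ^+ k) (basvec P i))
      = c i *: mxact ((adm z - S) ^+ k) (basvec P i).
    by rewrite (H m).1 Am mxact0.
  elim: k => [|k [IH1 IH2]]; first by rewrite !expr0 !mxact1.
  rewrite exprSr -[_ * _]/(_ *m _) mxactM IH1 exprSr -[_ * _]/(_ *m _) mxactM.
  set w := mxact (_ ^+ _) _ in IH2 *; split.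
    by rewrite !mxactD !mxactN IH2 -scalemx1 mxactZ mxact1.
  rewrite -mxactM mulmxBl AS -mulmxBr mxactM IH2 linearZ //.
(* S - r is the difference of the commuting operators ad z - r and ad z - S; in its power k + m
   every binomial term contains the k-th power of the first, which kills v, or the m-th power of the
   second, which is zero. As S is diagonalizable, (S - r)^(k + m) v = 0 gives S v = r v. *)
have Sgen r k v : mxact ((adm z - r%:M) ^+ k) v = 0 -> mxact S v = r *: v.
  move=> vk.
  have : mxact ((S - r%:M) ^+ (k + m)) v = 0.
    have -> : S - r%:M = (adm z - r%:M) - (adm z - S).
      by rewrite opprB [RHS]addrC addrA subrK.
    have cm : GRing.comm (adm z - r%:M) (adm z - S).
      have rC (A : 'M_(dim g)) : GRing.comm A r%:M by exact: scalar_mxC.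
      by apply: commrB; apply: commr_sym; apply: commrB.
    rewrite (exprBn_comm _ cm).
    apply: (big_ind (fun A => mxact A v = 0)) => [|A A' A0 A'0|i _].
    - exact: mxact0.
    - by rewrite mxactD A0 A'0 addr0.
    case: (leqP m i) => mi.
      have -> : (adm z - S) ^+ i = 0 by rewrite -(subnK mi) exprD Am mulr0.
      by rewrite mulr0 mul0rn mxact0.
    have ki : (k <= k + m - i)%N by rewrite -addnBA ?leq_addr // ltnW.
    set A := (adm z - r%:M) in vk *.
    have -> : A ^+ (k + m - i) = A ^+ k *m A ^+ (k + m - i - k).
      by rewrite -{1}(subnKC ki) exprD.
    rewrite -scaler_nat mxactZ -mulrA -signr_odd.
    case: (odd i); rewrite ?expr0 ?expr1 ?mulN1r ?mul1r ?mxactN;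
      by rewrite -[_ * _]/(_ *m _) !mxactM vk !linear0 ?oppr0 ?scaler0.
  have Sr i : mxact (S - r%:M) (basvec P i) = (c i - r) *: basvec P i.
    by rewrite mxactD mxactN Sb -scalemx1 mxactZ mxact1 scalerBl.
  move=> Srv; rewrite [v](bascoord_sum Pu) linear_sum scaler_sumr.
  apply: eq_bigr => i _; rewrite linearZ /= Sb !scalerA.
  have Srk j : mxact ((S - r%:M) ^+ (k + m)) (basvec P j) =
      (c j - r) ^+ (k + m) *: basvec P j.
    elim: (k + m)%N => [|q IH]; first by rewrite !expr0 mxact1 scale1r.
    by rewrite exprSr -[_ * _]/(_ *m _) mxactM IH linearZ /= Sr scalerA exprSr.
  have [|->|] := mxact_coord_eigen Pu (l := 0) (v := v) i Srk.
  - by rewrite Srv scale0r.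
  - by rewrite mul0r mulr0.
  by move=> /eqP; rewrite expf_eq0 subr_eq0 => /andP[_ /eqP ->]; rewrite mulrC.
have [zs Szs] : exists zs, S = adm zs.
  apply: inner_derivation; apply: (derivation_of_basis Pu) => i j.
  rewrite (Sgen (c i + c j) (m + m)%N).
    by rewrite !Sb lieZl lieZr scalerDl.
  exact: generalized_eigen_lie (leqnn _) (bgen i) (bgen j).
exists zs; rewrite -Szs; split=> //.
  by exists m; rewrite admB -Szs.
move=> x zx; rewrite -admE -Szs (Sgen 0 1%N) ?scale0r //.
by rewrite expr1 raddf0 subr0 admE.
Qed.

End Killing.

(** * Cartan subalgebras and roots *)

Section Cartan.
Variables (C : numClosedFieldType) (g : lieAlgebra C).
Hypothesis gs : simple_lie g.
Hypothesis K0 : exists x y : g, killing x y <> 0.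
Variable H : {vspace g}.
Hypothesis Hc : cartan H.
Implicit Types (x y z u v h e f t : g).

Lemma cartan_comm x y : x \in H -> y \in H -> lie x y = 0.
Proof. by have [[+ _] _] := Hc; apply. Qed.

Lemma cartan_diagonalizable h : h \in H -> diagonalizable (adm h).
Proof. by have [[_ +] _] := Hc => Hd hH; apply/ad_semisimpleP/Hd. Qed.

Lemma codiagonalizable_basis (As : seq 'M[C]_(dim g)) :
  {in As &, forall A B, comm_mx A B} -> {in As, forall A, diagonalizable A} ->
  exists2 P : 'M_(dim g), P \in unitmx & forall A, A \in As ->
    exists c, forall i, mxact A (basvec P i) = c i *: basvec P i.
Proof.
move=> Ac Ad; have [|P Pu /allP PA] := (codiagonalizableP As).1; first by [].
exists P => // A /PA /= /diagonalizable_forPex[d /(simmxP Pu) e].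
exists (d 0) => i; rewrite /mxact r2vK -row_mul e row_mul row_diag_mx.
by rewrite -scalemxAl -rowE linearZ.
Qed.

Lemma weight_basis : exists2 P : 'M_(dim g), P \in unitmx &
  exists b : 'I_(dim g) -> g -> C,
    forall i h, h \in H -> lie h (basvec P i) = b i h *: basvec P i.
Proof.
have [||P Pu PA] := @codiagonalizable_basis [seq adm h | h <- vbasis H].
- move=> _ _ /mapP[x xH ->] /mapP[y yH ->].
  by apply: adm_comm; apply: cartan_comm; exact: vbasis_mem.
- by move=> _ /mapP[x xH ->]; apply: cartan_diagonalizable; exact: vbasis_mem.
exists P => //; exists (fun i h => bascoord P i (lie h (basvec P i))) => i h hH.
suff [c ->] : exists c, lie h (basvec P i) = c *: basvec P i.
  by rewrite bascoordZ bascoordE // eqxx mulr1.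
rewrite (coord_vbasis hH) lie_suml.
apply: (big_ind (fun x => exists c, x = c *: basvec P i)) => [|x y [c ->] [d ->]|j _].
- by exists 0; rewrite scale0r.
- by exists (c + d); rewrite scalerDl.
have [|c cE] := PA (adm (vbasis H)`_j).
  by apply: map_f; rewrite mem_nth // size_tuple.
exists (coord (vbasis H) j h * c i).
by rewrite lieZl -scalerA -cE admE.
Qed.

(** Commuting diagonalizable operators have a common eigenbasis, so H + C z is toral again. *)
Lemma cartan_maximal z : diagonalizable (adm z) -> (forall h, h \in H -> lie z h = 0) ->
  z \in H.
Proof.
move=> zd zH; have [_ Hm] := Hc.
suff <- : (H + <[z]>)%VS = H by rewrite (subvP (addvSr _ _)) // memv_line.
apply: Hm; last exact: addvSl.
have zHC h : h \in H -> lie h z = 0 by move=> hH; rewrite lieC zH // oppr0.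
split=> [x y|x].
  move=> /memv_addP[h hH [_ /vlineP[a ->] ->]] /memv_addP[h' hH' [_ /vlineP[a' ->] ->]].
  rewrite lieDl !lieDr !lieZl !lieZr (cartan_comm hH hH') zH // zHC // lie_alternating.
  by rewrite !scaler0 !addr0.
move=> /memv_addP[h hH [_ /vlineP[a ->] ->]]; apply/ad_semisimpleP.
have [||P Pu PA] := @codiagonalizable_basis [:: adm h; adm z].
- move=> A B; rewrite !inE => /orP[]/eqP-> /orP[]/eqP-> //.
    by apply: adm_comm; rewrite zHC.
  by apply: adm_comm; rewrite zH.
- move=> A; rewrite !inE => /orP[]/eqP->; [exact: cartan_diagonalizable | exact: zd].
have [c cE] := PA (adm h) (mem_head _ _).
have [|d dE] := PA (adm z); first by rewrite !inE eqxx orbT.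
apply/diagonalizable_basis; exists P => //.
exists (fun i => a * d i + c i) => i; apply: r2v_inj.
rewrite -[row i P]r2vK -[LHS]/(mxact _ (basvec P i)) addrC admP mxactD mxactZ dE cE.
by rewrite scalerA -scalerDl r2vK linearZ.
Qed.

Definition weight0 z := forall h, h \in H -> lie h z = 0.

Lemma weight0_semisimple_part z : weight0 z ->
  exists2 zs, zs \in H & exists m, adm (z - zs) ^+ m = 0.
Proof.
move=> z0; have [zs [zd zn zx _]] := semisimple_part gs K0 z.
exists zs => //; apply: cartan_maximal => // h hH.
by apply: zx; rewrite lieC z0 // oppr0.
Qed.

Lemma killing_nilpotent x y m : lie x y = 0 -> adm y ^+ m = 0 -> killing x y = 0.
Proof.
move=> /adm_comm xy ym; apply: (@mxtrace_nilpotent _ _ _ m).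
have := exprMn_comm m (xy : GRing.comm (adm x) (adm y)).
by rewrite ym mulr0.
Qed.

(** The centralizer of H is orthogonal to every non-zero weight space, so the Killing form restricts
    to it without a radical. *)
Lemma weight0_killing_eq0 z : weight0 z -> (forall w, weight0 w -> killing z w = 0) -> z = 0.
Proof.
move=> z0 zK; have Ki := killing_inv g; have [P Pu [b bE]] := weight_basis.
apply: (form_nondegenerate gs Ki K0) => v.
rewrite [v](bascoord_sum Pu) (form_sumr Ki) big1 // => i _; rewrite (formZr Ki).
have [[h hH bh]|b0] := pselect (exists2 h, h \in H & b i h != 0).
  rewrite (form_ortho_eigen Ki (h := h) (a := 0) (b := b i h)) ?mulr0 ?add0r ?z0 ?scale0r //.
  exact: bE.
rewrite zK ?mulr0 // => h hH; rewrite bE //.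
have /eqP -> : b i h == 0 by apply: contra_notT b0 => bh; exists h.
by rewrite scale0r.
Qed.

(** Write z = zs + n with zs in H and n ad-nilpotent. In the centralizer of H the ad-nilpotent
    elements are exactly those orthogonal to H: one inclusion is [nK], the other ([Nn]) holds
    because the Killing form is nondegenerate on H. They thus form a subspace, on which
    [killing x x] = 0, and n turns out orthogonal to the whole centralizer. *)
Lemma cartan_self_centralizing z : weight0 z -> z \in H.
Proof.
have Ki := killing_inv g.
have w0H h : h \in H -> weight0 h by move=> hH h' h'H; exact: cartan_comm.
have w0B x y : weight0 x -> weight0 y -> weight0 (x - y).
  by move=> x0 y0 h hH; rewrite linearB /= x0 // y0 // subrr.
have KH h : h \in H -> (forall h', h' \in H -> killing h h' = 0) -> h = 0.
  move=> hH hK; apply: weight0_killing_eq0 => [|w w0]; first exact: w0H.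
  have [ws wsH [m wm]] := weight0_semisimple_part w0.
  rewrite -[w](subrK ws) (formDr Ki) (hK ws) // addr0.
  by apply: killing_nilpotent wm; apply: w0B hH => //; exact: w0H.
have Nn x : weight0 x -> (forall h, h \in H -> killing x h = 0) ->
    exists m, adm x ^+ m = 0.
  move=> x0 xK; have [xs xsH [m xm]] := weight0_semisimple_part x0.
  exists m; suff xs0 : xs = 0 by move: xm; rewrite xs0 subr0.
  apply: KH => // h hH; rewrite -[xs](subKr x) (formBl Ki) xK // sub0r (formC Ki).
  rewrite (killing_nilpotent _ xm) ?oppr0 //.
  by apply: w0B => //; exact: w0H.
have KN x : weight0 x -> (forall h, h \in H -> killing x h = 0) -> killing x x = 0.
  move=> x0 xK; have [m xm] := Nn x x0 xK.
  by apply: killing_nilpotent xm; exact: lie_alternating.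
move=> z0; have [zs zsH [m zm]] := weight0_semisimple_part z0.
suff /eqP : z - zs = 0 by rewrite subr_eq0 => /eqP ->.
have nK w k : weight0 w -> adm w ^+ k = 0 -> forall h, h \in H -> killing w h = 0.
  by move=> w0 wk h hH; rewrite (formC Ki); apply: killing_nilpotent wk; exact: w0.
have n0 : weight0 (z - zs) by apply: w0B => //; exact: w0H.
have nH := nK _ _ n0 zm.
apply: weight0_killing_eq0 => // w w0.
have [ws wsH [k wk]] := weight0_semisimple_part w0.
rewrite -[w](subrK ws) (formDr Ki) (nH ws) // addr0.
have wn0 : weight0 (w - ws) by apply: w0B => //; exact: w0H.
have wH := nK _ _ wn0 wk.
set x := z - zs in n0 nH *; set y := w - ws in wn0 wH *.
clearbody x y.
(* Polarization: the Killing form vanishes on the squares of nilpotents. *)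
have : killing (x + y) (x + y) = 0.
  apply: KN => [h hH|h hH]; first by rewrite linearD /= n0 // wn0 // addr0.
  by rewrite (formDl Ki) nH // wH // addr0.
rewrite (formDl Ki) !(formDr Ki) (KN x) // (KN y) // add0r addr0 (formC Ki y).
by move=> /eqP; rewrite -mulr2n mulrn_eq0 => /eqP.
Qed.


(** * Root vectors and root lengths *)

Section Roots.
Variable B : g -> g -> C.
Hypothesis Bi : invariant_symmetric_form B.
Hypothesis B0 : exists x y : g, B x y <> 0.

Definition weight_vector (c : g -> C) x := forall h, h \in H -> lie h x = c h *: x.

Lemma weight_vector_lie c d x y : weight_vector c x -> weight_vector d y ->
  weight_vector (fun h => c h + d h) (lie x y).
Proof.
move=> xc yd h hH; rewrite lie_derivation (xc h) // (yd h) // lieZl lieZr.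
by rewrite scalerDl.
Qed.

(** Some weight vector pairs non-trivially with [e], and invariance forces its weight to be - c.
    With the normalization [B e f = 1], the bracket [e, f] is itself the element of H that
    represents [c]. *)
Lemma root_vector_dual c e : e != 0 -> weight_vector c e ->
  exists2 f, weight_vector (fun h => - c h) f &
    [/\ B e f = 1, lie e f \in H & forall h, h \in H -> B (lie e f) h = c h].
Proof.
move=> e0 ec; have [P Pu [b bE]] := weight_basis.
have [i Bei] : exists i, B e (basvec P i) != 0.
  apply: contrapT => H0; move/eqP: e0; apply; apply: (form_nondegenerate gs Bi B0) => v.
  rewrite [v](bascoord_sum Pu) (form_sumr Bi) big1 // => i _; rewrite (formZr Bi).
  have [->|Bei] := eqVneq (B e (basvec P i)) 0; first by rewrite mulr0.
  by case: H0; exists i.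
have bi h : h \in H -> b i h = - c h.
  move=> hH; apply/eqP; rewrite -addr_eq0 addrC; apply: contraNT Bei => bc.
  by apply/eqP; apply: (form_ortho_eigen Bi (ec h hH) (bE i h hH)).
exists ((B e (basvec P i))^-1 *: basvec P i).
  by move=> h hH; rewrite lieZr bE // bi // !scalerA mulrC.
set f := _ *: _.
have fw : weight_vector (fun h => - c h) f.
  by move=> h hH; rewrite lieZr bE // bi // !scalerA mulrC.
have Bef : B e f = 1 by rewrite (formZr Bi) mulVf.
split=> // [|h hH].
  apply: cartan_self_centralizing => h hH.
  by rewrite (weight_vector_lie ec fw) // subrr scale0r.
by rewrite (form_inv Bi) lieC fw // -scaleNr opprK (formZr Bi) Bef mulr1.
Qed.

(** Otherwise the pairwise distinct numbers l + m rho would all be eigenvalues of ad h, more than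
    the dimension allows. *)
Lemma eigen_shift_nilpotent h x rho w l : h \in H -> lie h x = rho *: x -> rho != 0 ->
  lie h w = l *: w -> exists m, iter m (lie x) w = 0.
Proof.
move=> hH hx r0 hw; apply: contrapT => xw.
have [P Pu [c Pc]] := (diagonalizable_basis _).1 (cartan_diagonalizable hH).
have hb i : mxact (adm h) (basvec P i) = c i *: basvec P i.
  by rewrite /mxact r2vK Pc linearZ.
have hm m : lie h (iter m (lie x) w) = (l + m%:R * rho) *: iter m (lie x) w.
  elim: m => [|m IH]; first by rewrite mul0r addr0.
  rewrite iterS lie_derivation hx lieZl IH lieZr -scalerDl; congr (_ *: _).
  by rewrite -natr1; ring.
have ex m : exists i, c i = l + m%:R * rho.
  apply: contrapT => H0; apply: xw; exists m; set v := iter _ _ _ in hm *.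
  rewrite [LHS](bascoord_sum Pu) big1 // => i _.
  have av : mxact (adm h) v = (l + m%:R * rho) *: v by rewrite admE hm.
  have [->|ci] := mxact_coord_eigen Pu i hb av; first by rewrite scale0r.
  by case: H0; exists i.
pose f (m : 'I_(dim g).+1) := sval (cid (ex m)).
have finj : injective f.
  move=> m n; rewrite /f; case: cid => i /= ci; case: cid => j /= cj ij.
  move: cj; rewrite -ij ci => /addrI/(mulIf r0)/eqP.
  by rewrite eqr_nat => /eqP/val_inj.
by have := leq_card f finj; rewrite !card_ord ltnn.
Qed.

(* With e^(m+1) v = 0 and J the length of the f-string through e^m v, one finds
   l = mu (J / 2 - m). *)
Lemma string_eigenvalue_real e f h rho mu v l l0 : h \in H -> v != 0 ->
  lie h e = rho *: e -> lie h f = (- rho) *: f -> rho != 0 ->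
  lie (lie e f) e = mu *: e -> lie (lie e f) f = (- mu) *: f ->
  lie h v = l0 *: v -> lie (lie e f) v = l *: v ->
  exists2 q, q \is Num.real & l = mu * q.
Proof.
move=> hH v0 he hf r0 te tf hv tv.
set t := lie e f in te tf tv.
have last x w : w != 0 -> (exists m, iter m (lie x) w = 0) ->
    exists m, iter m (lie x) w != 0 /\ iter m.+1 (lie x) w = 0.
  move=> w0 xw; have ex : exists m, iter m (lie x) w == 0.
    by have [m /eqP] := xw; exists m.
  case: (ex_minnP ex) => -[|m] /eqP xm mmin; first by move/eqP: w0.
  by exists m; split=> //; apply/negP => /mmin; rewrite ltnn.
have shift a x c w d m : lie a x = c *: x -> lie a w = d *: w ->
    lie a (iter m (lie x) w) = (d + m%:R * c) *: iter m (lie x) w.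
  move=> ax aw; elim: m => [|m IH]; first by rewrite mul0r addr0.
  rewrite iterS lie_derivation ax lieZl IH lieZr -scalerDl; congr (_ *: _).
  by rewrite -natr1; ring.
have [m [w0 ew]] := last e v v0 (eigen_shift_nilpotent hH he r0 hv).
have tw := shift t e mu v l m te tv; have hw := shift h e rho v l0 m he hv.
rewrite iterS in ew; set w := iter m _ _ in w0 ew tw hw.
have nr0 : - rho != 0 by rewrite oppr_eq0.
have [J [u0 fu]] := last f w w0 (eigen_shift_nilpotent hH hf nr0 hw).
have tu j := shift t f (- mu) w _ j tf tw.
(* On the i-th iterate of [w] under ad f, [e, f] acts by l + m mu - i mu; the coefficient is the sum
   of these for i from 0 to j. *)
have eu j : lie e (iter j.+1 (lie f) w) =
    (j.+1%:R * (l + m%:R * mu) - 'C(j.+1, 2)%:R * mu) *: iter j (lie f) w.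
  elim: j => [|j IH].
    by rewrite /= lie_derivation ew linear0 addr0 tw bin_small // mul0r subr0 mul1r.
  rewrite iterS lie_derivation IH lieZr -/t tu -iterS -scalerDl; congr (_ *: _).
  by rewrite [in RHS]binS bin1 natrD -[j.+2%:R]natr1; ring.
have /eqP := eu J; rewrite fu linear0 eq_sym scaler_eq0 (negPf u0) orbF subr_eq0 => /eqP E.
exists ('C(J.+1, 2)%:R / J.+1%:R - m%:R).
  by rewrite rpredB ?rpredM ?rpredV ?realn.
have J0 : J.+1%:R != 0 :> C by rewrite pnatr_eq0.
rewrite -[LHS](addrK (m%:R * mu)); have -> : l + m%:R * mu = 'C(J.+1, 2)%:R * mu / J.+1%:R.
  by rewrite -E mulrAC divff // mul1r.
by ring.
Qed.

Definition nonzero_weight (c : g -> C) := exists2 h, h \in H & c h != 0.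

Lemma root_length_killing c e f : e != 0 -> nonzero_weight c -> weight_vector c e ->
  weight_vector (fun h => - c h) f -> lie e f \in H ->
  (forall h, h \in H -> B (lie e f) h = c h) ->
  B (lie e f) (lie e f) != 0 /\
  (* The eigenvalues of ad t, for t = [e, f], are real multiples r_i of [B t t], and p is the sum of
     the r_i^2. If [B t t] or p were zero, ad t would vanish and t would be zero, against c <> 0. *)
  exists2 p, 0 < p & killing (lie e f) (lie e f) = B (lie e f) (lie e f) ^+ 2 * p.
Proof.
move=> e0 [h0 h0H ch0] ec fc tH tB; set t := lie e f in tH tB *.
have mu : B t t = c t by rewrite tB.
have [P Pu [b bE]] := weight_basis.
have q i : exists q, q \is Num.real /\ b i t = B t t * q.
  have [|||||||q qr ->] := @string_eigenvalue_real e f h0 (c h0) (B t t) (basvec P i)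
    (b i t) (b i h0) h0H (basvec_neq0 Pu i).
  - exact: ec.
  - exact: fc.
  - exact: ch0.
  - by rewrite -/t ec // mu.
  - by rewrite -/t fc // mu.
  - exact: bE.
  - exact: bE.
  by exists q.
pose r i := sval (cid (q i)).
have rr i : r i \is Num.real by rewrite /r; case: cid => ? [].
have rE i : b i t = B t t * r i by rewrite /r; case: cid => ? [].
have tb i : lie t (basvec P i) = (B t t * r i) *: basvec P i by rewrite bE // rE.
have Ktt : killing t t = B t t ^+ 2 * \sum_i r i ^+ 2.
  rewrite /killing (mxtrace_eigenvectors Pu (c := fun i => (B t t * r i) ^+ 2)).
    by rewrite mulr_sumr; apply: eq_bigr => i _; rewrite exprMn.
  by move=> i; rewrite mxactM !admE tb lieZr tb scalerA.
have bt0 : ~ (forall i, b i t = 0).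
  move=> bi0; move: ch0; rewrite -tB //; suff -> : t = 0 by rewrite (form0l Bi) eqxx.
  apply: (center_eq0 gs) => y; rewrite [y](bascoord_sum Pu) linear_sum big1 // => i _.
  by rewrite /= lieZr bE // bi0 scale0r scaler0.
split; first by apply/negP => /eqP m0; apply: bt0 => i; rewrite rE m0 mul0r.
exists (\sum_i r i ^+ 2) => //.
have r2 i : 0 <= r i ^+ 2 by rewrite real_exprn_even_ge0.
rewrite lt0r sumr_ge0 // andbT; apply/negP; rewrite psumr_eq0 // => /allP r0.
apply: bt0 => i; have := r0 i (mem_index_enum i).
by rewrite /= expf_eq0 rE => /eqP ->; rewrite mulr0.
Qed.

Hypothesis tlen : exists t e, [/\ t \in H, e != 0, weight_vector (B t) e & B t t = 2].

(** The Killing form is k B, and [root_length_killing] reads k = [B t t] p with p > 0 for every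
    root. The root of squared length 2 shows k > 0, which then makes every [B t t] positive. *)
Lemma root_length_gt0 c e f : e != 0 -> nonzero_weight c -> weight_vector c e ->
  weight_vector (fun h => - c h) f -> lie e f \in H ->
  (forall h, h \in H -> B (lie e f) h = c h) -> 0 < B (lie e f) (lie e f).
Proof.
have [t [e1 [tH e10 te1 tt]]] := tlen.
have [k kE] := form_proportional gs Bi B0 (killing_inv g).
have [f1 f1w [_ t1H t1B]] := root_vector_dual e10 te1.
have nz1 : nonzero_weight (B t) by exists t => //; rewrite tt pnatr_eq0.
have tt1 : B (lie e1 f1) (lie e1 f1) = 2.
  by rewrite t1B // (formC Bi) t1B.
have [_ [p p0]] := root_length_killing e10 nz1 te1 f1w t1H t1B.
have two0 : 2 != 0 :> C by rewrite pnatr_eq0.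
rewrite kE tt1 expr2 -mulrA mulrC => /(mulfI two0) kp.
have k0 : 0 < k by rewrite kp mulr_gt0 ?ltr0n.
move=> e0 nz ec fc eH eB; have [m0 [r r0]] := root_length_killing e0 nz ec fc eH eB.
rewrite kE expr2 -mulrA mulrC => /(mulfI m0) kr.
by move: k0; rewrite kr pmulr_lgt0.
Qed.

Hypothesis short_roots : forall t e, t \in H -> e != 0 -> weight_vector (B t) e ->
  nonzero_weight (B t) -> B t t <= 2.

Lemma root_length_bounds c e : e != 0 -> nonzero_weight c -> weight_vector c e ->
  exists t, [/\ t \in H, forall h, h \in H -> B t h = c h, 0 < B t t & B t t <= 2].
Proof.
move=> e0 nz ec; have [f fc [_ tH tB]] := root_vector_dual e0 ec.
exists (lie e f); split=> //; first exact: (root_length_gt0 e0 nz ec fc).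
apply: (short_roots tH e0) => [h hH|]; first by rewrite tB // ec.
by have [h hH ch] := nz; exists h; rewrite ?tB.
Qed.

Lemma nonzero_weightPn c : ~ nonzero_weight c -> forall h, h \in H -> c h = 0.
Proof.
by move=> nz h hH; apply/eqP; apply: contra_notT nz => ch; exists h.
Qed.

(* For a weight vector a of weight b, the squared lengths of b, b + t and
   b + 2 t satisfy q0 + q2 = 2 q1 + 4, whereas q0, q2 <= 2 and q1 > 0 when these
   three are nonzero. *)
Lemma long_root_vector_extremal t e a : t \in H -> e != 0 -> weight_vector (B t) e ->
  B t t = 2 -> exists c, lie e (lie e a) = c *: e.
Proof.
move=> tH e0 te tt; have [P Pu [b bE]] := weight_basis.
rewrite [a](bascoord_sum Pu) !linear_sum /=.
apply: (big_ind (fun x => exists c, x = c *: e)) => [|x y [c ->] [d ->]|i _].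
- by exists 0; rewrite scale0r.
- by exists (c + d); rewrite scalerDl.
rewrite !lieZr; suff [c ->] : exists c, lie e (lie e (basvec P i)) = c *: e.
  by exists (bascoord P i a * c); rewrite scalerA.
have a0 := basvec_neq0 Pu i; set v := basvec P i in a0 *.
have aw : weight_vector (b i) v by move=> h hH; exact: bE.
have eh h : h \in H -> lie e h = - B t h *: e.
  by move=> hH; rewrite lieC te // scaleNr.
have ew := weight_vector_lie te aw; have eew := weight_vector_lie te ew.
have [v20|v20] := eqVneq (lie e (lie e v)) 0; first by exists 0; rewrite scale0r.
have v10 : lie e v != 0 by apply: contraNneq v20 => ->; rewrite linear0.
have [nz0|/nonzero_weightPn z0] := pselect (nonzero_weight (b i)); last first.
  have vH : v \in H by apply: cartan_self_centralizing => h hH; rewrite aw // z0 // scale0r.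
  by case/eqP: v20; rewrite (eh v) // lieZr lie_alternating scaler0.
have [nz1|/nonzero_weightPn z1] := pselect (nonzero_weight (fun h => B t h + b i h)); last first.
  exists (- B t (lie e v)); apply: eh.
  by apply: cartan_self_centralizing => h hH; rewrite ew // z1 // scale0r.
have [t0 [t0H t0B q0p q02]] := root_length_bounds a0 nz0 aw.
(* If b + 2 t = 0, the root b has squared length 4 * 2 = 8, above the bound 2. *)
have [nz2|/nonzero_weightPn z2] :=
    pselect (nonzero_weight (fun h => B t h + (B t h + b i h))); last first.
  have t0h h : h \in H -> B t0 h = - (2 * B t h).
    move=> hH; rewrite t0B //; apply/eqP; rewrite -addr_eq0 addrC.
    by rewrite mulr_natl mulr2n -addrA z2.
  move: q02; rewrite t0h // (formC Bi) t0h // tt mulrN opprK.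
  by rewrite -!natrM ler_nat.
have [t1 [t1H t1B q1p q12]] := root_length_bounds v10 nz1 ew.
have [t2 [t2H t2B q2p q22]] := root_length_bounds v20 nz2 eew.
have q1 : B t1 t1 = B t0 t0 + B t t0 *+ 2 + 2.
  rewrite t1B // (formC Bi) t1B // -t0B // -t0B // (formC Bi t0 t1) t1B // -t0B //.
  by rewrite tt (formC Bi t0 t); ring.
have q2 : B t2 t2 = B t0 t0 + B t t0 *+ 4 + 8.
  rewrite t2B // (formC Bi) t2B // -!t0B // (formC Bi t0 t2) t2B // -t0B //.
  by rewrite tt (formC Bi t0 t); ring.
have : B t1 t1 *+ 2 <= 0.
  have -> : B t1 t1 *+ 2 = B t0 t0 + B t2 t2 - 4 by rewrite q1 q2; ring.
  rewrite subr_le0; have -> : 4 = 2 + 2 :> C by rewrite -natrD.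
  exact: lerD.
by rewrite pmulrn_rle0 // => /(lt_le_trans q1p); rewrite ltxx.
Qed.

End Roots.

End Cartan.

(** The coefficient is found by pairing with [f]: by invariance B([e, [e, a]], f) = - B([[e, f], e],
    a), and [[e, f], e] = 2 e because the root has squared length 2. *)
Lemma normalized_extremal_vector (C : numClosedFieldType) (g : lieAlgebra C)
    (B : g -> g -> C) : simple_lie g -> normalized_form B ->
  (exists x y : g, killing x y <> 0) /\ exists e f : g, B e f = 1 /\
    forall a, lie e (lie e a) = - (2 * B e a) *: e.
Proof.
move=> gs [Bi [H Hc [[alpha [[a0 [e e0 ea]] long]] norm]]].
have [t ta tt] := norm alpha (conj (conj a0 (ex_intro2 _ _ e e0 ea)) long).
have tH := subvsP t.
have te : weight_vector H (B (vsval t)) e.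
  move=> h hH; have := ea (vsproj H h); rewrite vsprojK // => ->.
  by rewrite -ta vsprojK.
have B0 : exists x y, B x y <> 0.
  by exists (vsval t), (vsval t); rewrite tt; apply/eqP; rewrite pnatr_eq0.
have K0 : exists x y : g, killing x y <> 0.
  apply: (killing_neq0 gs (t := vsval t) (e := e)) => //.
    by have [[_ Hd] _] := Hc; exact: Hd.
  by rewrite te // tt scaler_nat.
have tlen : exists t e, [/\ t \in H, e != 0, weight_vector H (B t) e & B t t = 2].
  by exists (vsval t), e.
have short u x : u \in H -> x != 0 -> weight_vector H (B u) x ->
    nonzero_weight H (B u) -> B u u <= 2.
  move=> uH x0 ux [h hH uh].
  have Bul : linear (fun h : subvs_of H => B u (vsval h) : C^o).
    move=> c v w; rewrite linearP (formDr Bi) (formZr Bi) //.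
  pose f : {linear subvs_of H -> C^o} := HB.pack (fun h : subvs_of H => B u (vsval h) : C^o)
    (GRing.isLinear.Build C (subvs_of H) C^o _ _ Bul).
  apply: (long (linfun f)).
  - split; last by exists x => // v; rewrite lfunE /=; apply: ux; exact: subvsP.
    apply: contraNneq uh => f0; have := lfunE f (vsproj H h).
    by rewrite f0 zero_lfunE /= vsprojK // => <-.
  - by exists t.
  - exists (vsproj H u) => [v|]; rewrite ?lfunE /= vsprojK //.
have [f fw [ef hH hB]] := root_vector_dual gs K0 Hc Bi B0 e0 te.
have he : lie (lie e f) e = 2 *: e.
  by rewrite te // (formC Bi) hB ?tt.
split=> //; exists e, f; split=> // a.
have [c cE] := long_root_vector_extremal gs K0 Hc Bi B0 tlen short a tH e0 te tt.
rewrite cE; congr (_ *: _).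
have <- : B (lie e (lie e a)) f = c by rewrite cE (formZl Bi) ef mulr1.
rewrite (lieC e (lie e a)) (formNl Bi) 2!(form_inv Bi) (lieC a) (formNr Bi).
by rewrite -(form_inv Bi) (lieC e (lie e f)) (formNl Bi) opprK he (formZl Bi).
Qed.

(** * Whitehead's lemma *)

Section Whitehead.
Variables (C : numClosedFieldType) (g : lieAlgebra C).
Hypothesis gs : simple_lie g.
Hypothesis K0 : exists x y : g, killing x y <> 0.
Implicit Types (x y z u v : g).

Let Ki := killing_inv g.

(** The basis dual to [stdvec] under the Killing form. *)
Definition dualvec i : g := r2v (row i (invmx (gram (@killing C g)))).

Lemma killing_dualvec i v : killing (dualvec i) v = v2r v 0 i.
Proof.
rewrite [v in LHS]stdvec_sum (form_sumr Ki) (bigD1 i) //=.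
have dE j : killing (dualvec i) (stdvec j) = (i == j)%:R.
  rewrite -gramE // /dualvec r2vK -row_mul mulVmx ?(gram_unit gs Ki K0) //.
  by rewrite !mxE.
rewrite big1 => [|j ji]; last by rewrite (formZr Ki) dE eq_sym (negPf ji) mulr0.
by rewrite (formZr Ki) dE eqxx mulr1 addr0.
Qed.

Lemma killing_dual_sum v : v = \sum_i killing (stdvec i) v *: dualvec i.
Proof.
apply/eqP; rewrite -subr_eq0; apply/eqP; apply: (form_nondegenerate gs Ki K0).
apply: (form_eq_stdvec Ki) => j; rewrite (formBl Ki) (formC Ki _ (stdvec j)).
rewrite (formC Ki (\sum_i _)) (form_sumr Ki) (bigD1 j) //=.
have stdE i : v2r (stdvec j) 0 i = (j == i)%:R.
  by rewrite /stdvec /basvec r2vK !mxE.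
rewrite big1 => [|i ij].
  by rewrite (formZr Ki) (formC Ki _ (dualvec j)) killing_dualvec stdE eqxx mulr1 addr0 subrr.
by rewrite (formZr Ki) (formC Ki _ (dualvec i)) killing_dualvec stdE eq_sym (negPf ij) mulr0.
Qed.

(** Invariance of the Casimir tensor, the sum of the x_i tensor x^i, tested on a bilinear map: ad z
    has opposite transposed matrices in the two dual bases. *)
Lemma dual_bases_invariant (b : g -> g -> g) z :
  bilinear_map b ->
  \sum_i b (lie z (stdvec i)) (dualvec i) = - \sum_i b (stdvec i) (lie z (dualvec i)).
Proof.
move=> [b1 b2].
have bl v I (r : seq I) (c : I -> C) (G : I -> g) :
    b (\sum_(i <- r) c i *: G i) v = \sum_(i <- r) c i *: b (G i) v.
  pose f : {linear g -> g} := HB.pack (b^~ v) (GRing.isLinear.Build C g g _ _ (b2 v)).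
  by rewrite -[LHS]/(f _) linear_sum; apply: eq_bigr => i _; rewrite linearZ.
have br u I (r : seq I) (c : I -> C) (G : I -> g) :
    b u (\sum_(i <- r) c i *: G i) = \sum_(i <- r) c i *: b u (G i).
  pose f : {linear g -> g} := HB.pack (b u) (GRing.isLinear.Build C g g _ _ (b1 u)).
  by rewrite -[LHS]/(f _) linear_sum; apply: eq_bigr => i _; rewrite linearZ.
rewrite -sumrN.
under eq_bigr => i _ do rewrite [lie z (stdvec i)]stdvec_sum bl.
under [RHS]eq_bigr => i _ do rewrite [lie z (dualvec i)]killing_dual_sum br -sumrN.
rewrite exchange_big; apply: eq_bigr => i _; apply: eq_bigr => j _.
rewrite -killing_dualvec -scaleNr; congr (_ *: _).
by rewrite -(form_inv Ki (stdvec j)) (formC Ki (lie _ z)) (lieC (stdvec j)) (formNr Ki) opprK.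
Qed.

(** Paired with z, the left side is the trace of ad y ad z written in dual bases, which is the
    Killing form itself; hence the eigenvalue is 1. *)
Lemma casimir_adjoint y : \sum_i lie (stdvec i) (lie (dualvec i) y) = y.
Proof.
apply/eqP; rewrite -subr_eq0; apply/eqP; apply: (form_nondegenerate gs Ki K0) => z.
rewrite (formBl Ki) (formC Ki y) [killing z y]/killing (mxtrace_basvec (unitmx1 _ _)).
rewrite (formC Ki (\sum_i _)) (form_sumr Ki) -sumrB big1 // => i _.
rewrite mxactM !admE /bascoord invmx1 mulmx1 -/(stdvec i) -killing_dualvec.
rewrite (formC Ki z) (lieC (stdvec i)) (formNl Ki) (form_inv Ki) (form_inv Ki).
by rewrite (lieC z) linearN /= (formNr Ki) subrr.
Qed.

(* Whitehead's second lemma for the adjoint module: the Casimir element, which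
   acts as the identity, gives the homotopy phi y = sum_i [x_i, psi(x^i, y)]. *)
Lemma adjoint_cocycle_coboundary (psi : g -> g -> g) : bilinear_map psi ->
  (forall x y, psi x y = - psi y x) ->
  (forall x y z, lie x (psi y z) + psi x (lie y z) =
     lie (psi x y) z + psi (lie x y) z + (lie y (psi x z) + psi y (lie x z))) ->
  exists2 phi : g -> g, linear phi & forall y z,
    psi y z = lie (phi y) z + lie y (phi z) - phi (lie y z).
Proof.
move=> [p1 p2] pC pd.
have pN x y : psi (- x) y = - psi x y.
  have := p2 y (-1) x 0; have := p2 y 1 0 0; rewrite /= !scale1r addr0.
  by rewrite -[X in X = _]addr0 => /addrI <-; rewrite !addr0 !scaleN1r.
pose phi y := \sum_i lie (stdvec i) (psi (dualvec i) y).
have phi_lin : linear phi.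
  move=> a u v; rewrite /phi scaler_sumr -big_split; apply: eq_bigr => i _.
  by rewrite p1 linearP.
exists phi => // y z.
have inv u v : \sum_i lie (lie u (stdvec i)) (psi (dualvec i) v) =
    - \sum_i lie (stdvec i) (psi (lie u (dualvec i)) v).
  apply: (@dual_bases_invariant (fun a b => lie a (psi b v))); split=> [a|b] c x x'.
    by rewrite p2 linearP.
  by rewrite lieDl lieZl.
rewrite -[psi y z]casimir_adjoint.
have pE i : lie (dualvec i) (psi y z) =
    lie (psi (dualvec i) y) z + psi (lie (dualvec i) y) z +
    (lie y (psi (dualvec i) z) + psi y (lie (dualvec i) z)) - psi (dualvec i) (lie y z).
  by rewrite -pd addrK.
under eq_bigr => i _ do rewrite pE linearB /= !linearD /=.
rewrite sumrB; congr (_ - _); rewrite !big_split /=.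
(* Commuting ad y and ad z past the x_i leaves the terms [Q z y] and [Q y z], each occurring twice
   with opposite signs. *)
pose Q u v := \sum_i lie (lie u (stdvec i)) (psi (dualvec i) v).
have -> : \sum_i lie (stdvec i) (lie (psi (dualvec i) y) z) = lie (phi y) z + Q z y.
  rewrite lie_suml -big_split; apply: eq_bigr => i _ /=.
  by rewrite lie_derivation (lieC z) lieNl -lieC.
have -> : \sum_i lie (stdvec i) (lie y (psi (dualvec i) z)) = lie y (phi z) - Q y z.
  rewrite linear_sum -sumrB; apply: eq_bigr => i _ /=.
  by rewrite lie_derivation addrC (lieC y (stdvec i)) lieNl opprK.
have -> : \sum_i lie (stdvec i) (psi (lie (dualvec i) y) z) = Q y z.
  rewrite /Q inv -sumrN; apply: eq_bigr => i _.
  by rewrite (lieC (dualvec i)) pN linearN.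
have -> : \sum_i lie (stdvec i) (psi y (lie (dualvec i) z)) = - Q z y.
  rewrite /Q inv opprK; apply: eq_bigr => i _.
  by rewrite pC (lieC (dualvec i)) pN opprK.
rewrite -(addrA (lie (phi y) z)) [_ - Q y z - _]addrAC -(addrA (lie y (phi z))).
by rewrite -opprD addrACA subrr addr0.
Qed.

End Whitehead.

Local Open Scope classical_set_scope.
Local Open Scope ring_scope.

(** * Vertex operators *)

Section LinearFunctions.
Variables (C : fieldType) (U W : lmodType C) (f : U -> W).
Hypothesis fl : linear f.

Lemma linear_fun0 : f 0 = 0.
Proof. by have := fl (-1) 0 0; rewrite scaler0 addr0 scaleN1r addNr. Qed.

Lemma linear_funZ a u : f (a *: u) = a *: f u.
Proof. by have := fl a u 0; rewrite !addr0 linear_fun0 addr0. Qed.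

Lemma linear_funD u v : f (u + v) = f u + f v.
Proof. by have := fl 1 u v; rewrite !scale1r. Qed.

Lemma linear_funN u : f (- u) = - f u.
Proof. by rewrite -scaleN1r linear_funZ scaleN1r. Qed.

Lemma linear_funB u v : f (u - v) = f u - f v.
Proof. by rewrite linear_funD linear_funN. Qed.

Lemma linear_fun_sum I (r : seq I) (P : pred I) (F : I -> U) :
  f (\sum_(i <- r | P i) F i) = \sum_(i <- r | P i) f (F i).
Proof. by apply: (big_morph f); [exact: linear_funD | exact: linear_fun0]. Qed.

End LinearFunctions.

Section DeltaFunctions.
Variables (C : fieldType) (V : lmodType C).

Lemma fsbig_nat_bounded (F : nat -> V) N : (forall i, (N <= i)%N -> F i = 0) ->
  \sum_(i \in [set: nat]) F i = \sum_(i < N) F i.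
Proof.
move=> F0; rewrite fsbig_ord; apply/esym/fsbig_widen => // i [_ /= iN].
by apply: F0; rewrite leqNgt; apply/negP.
Qed.

Lemma fsbig_nat1 (F : nat -> V) : (forall i, (0 < i)%N -> F i = 0) ->
  \sum_(i \in [set: nat]) F i = F 0.
Proof. by move=> F0; rewrite (fsbig_nat_bounded (N := 1)) // big_ord1. Qed.

Lemma binz0 m : binz C m 0 = 1.
Proof. by rewrite /binz big_ord0 divr1. Qed.

Lemma binz_eq0 (m i : nat) : (m < i)%N -> binz C m i = 0.
Proof.
by move=> mi; rewrite /binz (bigD1 (Ordinal mi)) //= subrr !mul0r.
Qed.

(** This is the binomial coefficient m over i, in the form in which [delta_x1_sub_x0] produces
    it. *)
Definition comm_coef (m : int) (i : nat) : C := (-1) ^+ i * binz C (i%:Z - m - 1) i.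

Lemma comm_coef0 m : comm_coef m 0 = 1.
Proof. by rewrite /comm_coef binz0 expr0 mulr1. Qed.

Lemma comm_coef1 m : comm_coef m 1 = m%:~R.
Proof.
rewrite /comm_coef /binz big_ord1 divr1 expr1 mulN1r -rmorphN /=; congr (_%:~R).
by ring.
Qed.

Definition is_jacobi (P Q R : int -> int -> V) := forall l m n,
  delta_x1_sub_x2 P l m n - delta_opp_x2_add_x1 Q l m n = delta_x1_sub_x0 R l m n.

(** At l = 0 the coefficients 0 over i vanish for i > 0, so each delta function on the left keeps
    one term. *)
Lemma jacobi_commutator P Q R m n N : is_jacobi P Q R ->
  (forall i : nat, (N <= i)%N -> R i%:Z (m + n - i%:Z) = 0) ->
  P m n - Q m n = \sum_(i < N) comm_coef m i *: R i%:Z (m + n - i%:Z).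
Proof.
move=> /(_ 0 m n) J R0.
have b0 (i : nat) : (0 < i)%N -> binz C 0 i = 0 by exact: binz_eq0.
move: J; rewrite /delta_x1_sub_x2 fsbig_nat1 => [|i /b0 ->]; last by rewrite mulr0 scale0r.
rewrite /delta_opp_x2_add_x1 fsbig_nat1 => [|i /b0 ->]; last by rewrite mulr0 scale0r.
have -> : (-1) ^ (0 - 0%:Z) = 1 :> C by [].
rewrite !binz0 expr0 !mulr1 !scale1r.
have -> : P (m + 0 - 0%:Z) (n + 0%:Z) = P m n by congr P; lia.
have -> : Q (m + 0%:Z) (n + 0 - 0%:Z) = Q m n by congr Q; lia.
move=> ->.
rewrite /delta_x1_sub_x0 (fsbig_nat_bounded (N := N)) => [|i Ni].
  by apply: eq_bigr => i _; rewrite add0r.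
by rewrite add0r R0 // scaler0.
Qed.

(** At m = 0 the coefficients i - 1 over i vanish for i > 0, so the right side keeps one term. *)
Lemma jacobi_iterate P Q R l n N : is_jacobi P Q R ->
  (forall i : nat, (N <= i)%N -> P (l - i%:Z) (n + i%:Z) = 0 /\ Q i%:Z (n + l - i%:Z) = 0) ->
  R l n = \sum_(i < N) ((-1) ^+ i * binz C l i) *: P (l - i%:Z) (n + i%:Z)
    - \sum_(i < N) ((-1) ^ (l - i%:Z) * binz C l i) *: Q i%:Z (n + l - i%:Z).
Proof.
move=> /(_ l 0 n) J PQ0.
have -> : R l n = delta_x1_sub_x0 R l 0 n.
  rewrite /delta_x1_sub_x0 fsbig_nat1 => [|[|i] // _].
    by rewrite binz0 expr0 mulr1 scale1r; congr R; lia.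
  have -> : i.+1%:Z - 0 - 1 = i%:Z by lia.
  by rewrite binz_eq0 // mulr0 scale0r.
rewrite -J /delta_x1_sub_x2 /delta_opp_x2_add_x1.
rewrite !(fsbig_nat_bounded (N := N)) => [|i Ni|i Ni].
- congr (_ - _); apply: eq_bigr => i _; by rewrite add0r.
- by rewrite add0r (PQ0 i Ni).2 scaler0.
- by rewrite add0r (PQ0 i Ni).1 scaler0.
Qed.

End DeltaFunctions.

(* The consequences of the Jacobi identity that are used: the commutator formula
   (the residue in x0) and the iterate formula (the residue in x1). *)
Record vertex_operator (C : fieldType) (M : lmodType C) (Ym : M -> int -> M -> M) : Prop :=
  VertexOperator {
  vo_bilinear : forall n, bilinear_map (fun u v => Ym u n v);
  vo_commutator : forall u v w m n, exists N0, forall N, (N0 <= N)%N ->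
    Ym u m (Ym v n w) - Ym v n (Ym u m w)
    = \sum_(i < N) comm_coef C m i *: Ym (Ym u i%:Z v) (m + n - i%:Z) w;
  vo_iterate : forall u v w l n, exists N0, forall N, (N0 <= N)%N ->
    Ym (Ym u l v) n w =
    \sum_(i < N) ((-1) ^+ i * binz C l i) *: Ym u (l - i%:Z) (Ym v (n + i%:Z) w)
    - \sum_(i < N) ((-1) ^ (l - i%:Z) * binz C l i) *: Ym v (n + l - i%:Z) (Ym u i%:Z w)
}.

Section VertexOperator.
Variables (C : fieldType) (M : lmodType C) (Ym : M -> int -> M -> M).
Hypothesis vo : vertex_operator Ym.

Lemma voDr u n v w : Ym u n (v + w) = Ym u n v + Ym u n w.
Proof. by have := (vo_bilinear vo n).1 u 1 v w; rewrite !scale1r. Qed.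

Lemma voDl u n v w : Ym (u + v) n w = Ym u n w + Ym v n w.
Proof. by have := (vo_bilinear vo n).2 w 1 u v; rewrite /= !scale1r. Qed.

Lemma vo0r u n : Ym u n 0 = 0.
Proof. by apply: (addrI (Ym u n 0)); rewrite -voDr !addr0. Qed.

Lemma vo0l n w : Ym 0 n w = 0.
Proof. by apply: (addrI (Ym 0 n w)); rewrite -voDl !addr0. Qed.

Lemma voZr u n a v : Ym u n (a *: v) = a *: Ym u n v.
Proof. by have := (vo_bilinear vo n).1 u a v 0; rewrite !addr0 vo0r addr0. Qed.

Lemma voZl n a u w : Ym (a *: u) n w = a *: Ym u n w.
Proof. by have := (vo_bilinear vo n).2 w a u 0; rewrite /= !addr0 vo0l addr0. Qed.

Lemma voNl n u w : Ym (- u) n w = - Ym u n w.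
Proof. by rewrite -scaleN1r voZl scaleN1r. Qed.

Lemma voNr n u w : Ym u n (- w) = - Ym u n w.
Proof. by rewrite -scaleN1r voZr scaleN1r. Qed.

Lemma vo_commutator_quadratic u v w m n : (forall i, 2 <= i -> Ym u i v = 0) ->
  Ym u m (Ym v n w) - Ym v n (Ym u m w)
  = Ym (Ym u 0 v) (m + n) w + m%:~R *: Ym (Ym u 1 v) (m + n - 1) w.
Proof.
move=> uv; have [N0 /(_ _ (leq_maxl N0 2)) ->] := vo_commutator vo u v w m n.
rewrite -(subnK (leq_maxr N0 2)) addnC big_split_ord /= [X in _ + X]big1 => [|i _].
  rewrite addr0 big_ord_recl big_ord1 /= comm_coef0 scale1r subr0.
  by rewrite /bump /= addn0 comm_coef1.
by rewrite uv ?vo0l ?scaler0 // lez_nat leq_addr.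
Qed.

End VertexOperator.

Lemma va_vertex_operator (C : fieldType) (V : vertexAlgebra C) :
  vertex_operator (@Y C V).
Proof.
have Yb := @va_bilinear C V; have Yt := @va_truncated C V.
have Y0r (u : V) n : Y u n 0 = 0.
  have := (Yb n).1 u 1 0 0; rewrite /= scaler0 addr0 scale1r.
  by rewrite -[X in X = _]addr0 => /addrI.
have Y0l n (w : V) : Y 0 n w = 0.
  have := (Yb n).2 w 1 0 0; rewrite /= scaler0 addr0 scale1r.
  by rewrite -[X in X = _]addr0 => /addrI.
split=> // [u v w m n|u v w l n].
  have [N uv] := Yt u v; exists `|N|%N => K NK.
  apply: (jacobi_commutator (va_jacobi u v w)) => i Ki.
  by rewrite uv ?Y0l //; lia.
have [N1 vw] := Yt v w; have [N2 uw] := Yt u w.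
exists (`|N1 - n| + `|N2|)%N => K NK.
apply: (jacobi_iterate (va_jacobi u v w)) => i Ki.
by split; rewrite (vw, uw) ?Y0r //; lia.
Qed.

(** * The vertex operator over the dual numbers *)

Section DualNumbers.
Variables (C : fieldType) (V : vertexAlgebra C) (Y1 : V -> int -> V -> V).
Hypothesis dY : first_order_deformation Y1.

(* V[t]/(t^2), with x.1 + t x.2 represented by the pair x. *)
Definition dualY (x : V * V) (n : int) (y : V * V) : V * V :=
  (Y x.1 n y.1, Y x.1 n y.2 + Y x.2 n y.1 + Y1 x.1 n y.1).

Let voY := va_vertex_operator V.

Lemma def_bilinear n : bilinear_map (fun u v => Y1 u n v).
Proof. by have [[+ _] _ _ _ _] := dY. Qed.

Lemma Y1Dr u n v w : Y1 u n (v + w) = Y1 u n v + Y1 u n w.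
Proof. by have := (def_bilinear n).1 u 1 v w; rewrite !scale1r. Qed.

Lemma Y1Dl u n v w : Y1 (u + v) n w = Y1 u n w + Y1 v n w.
Proof. by have := (def_bilinear n).2 w 1 u v; rewrite /= !scale1r. Qed.

Lemma Y10r u n : Y1 u n 0 = 0.
Proof. by apply: (addrI (Y1 u n 0)); rewrite -Y1Dr !addr0. Qed.

Lemma Y10l n w : Y1 0 n w = 0.
Proof. by apply: (addrI (Y1 0 n w)); rewrite -Y1Dl !addr0. Qed.

Lemma pair_sum N (c : 'I_N -> C) (F G : 'I_N -> V) :
  \sum_(i < N) c i *: ((F i, G i) : V * V) = (\sum_(i < N) c i *: F i, \sum_(i < N) c i *: G i).
Proof.
apply: (big_ind3 (fun (x : V * V) y z => x = (y, z))) => // x1 x2 x3 y1 y2 y3 -> -> //.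
Qed.

Lemma def_commutator u v w m n : exists N0, forall N, (N0 <= N)%N ->
  Y1 u m (Y v n w) + Y u m (Y1 v n w) - (Y1 v n (Y u m w) + Y v n (Y1 u m w))
  = \sum_(i < N) comm_coef C m i *:
      (Y1 (Y u i%:Z v) (m + n - i%:Z) w + Y (Y1 u i%:Z v) (m + n - i%:Z) w).
Proof.
have [[_ Yt1] _ _ _ J1] := dY; have Yt := @va_truncated C V.
have [N1 uv1] := Yt1 u v; have [N uv] := Yt u v.
exists (`|N1| + `|N|)%N => K NK.
apply: (jacobi_commutator (J1 u v w)) => i Ki.
by rewrite uv ?uv1 ?Y10l ?(vo0l voY) ?addr0 //; lia.
Qed.

Lemma def_iterate u v w l n : exists N0, forall N, (N0 <= N)%N ->
  Y1 (Y u l v) n w + Y (Y1 u l v) n w =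
  \sum_(i < N) ((-1) ^+ i * binz C l i) *:
      (Y1 u (l - i%:Z) (Y v (n + i%:Z) w) + Y u (l - i%:Z) (Y1 v (n + i%:Z) w))
  - \sum_(i < N) ((-1) ^ (l - i%:Z) * binz C l i) *:
      (Y1 v (n + l - i%:Z) (Y u i%:Z w) + Y v (n + l - i%:Z) (Y1 u i%:Z w)).
Proof.
have [[_ Yt1] _ _ _ J1] := dY; have Yt := @va_truncated C V.
have [N1 vw1] := Yt1 v w; have [N2 vw] := Yt v w.
have [N3 uw1] := Yt1 u w; have [N4 uw] := Yt u w.
exists (`|N1 - n| + `|N2 - n| + `|N3| + `|N4|)%N => K NK.
apply: (jacobi_iterate (J1 u v w)) => i Ki.
by split; rewrite (vw, uw) ?(vw1, uw1) ?Y10r ?(vo0r voY) ?addr0 //; lia.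
Qed.

(** The t-part of each identity is the identity of [Y] with t carried by w, v or u ([H2], [H3],
    [H4]), plus the deformed identity ([H5]). *)
Lemma dualY_vertex_operator : vertex_operator dualY.
Proof.
have commS (a b c d e a' b' c' d' e' : V) : (a + b + c + d + e) - (a' + b' + c' + d' + e')
    = (a - a') + (b - d') + (d - b') + ((e + c) - (e' + c')).
  by rewrite !opprD (AC (5*5) ((1*6)*(2*9)*(4*7)*((5*3)*(10*8)))).
split=> [n|u v w m n|u v w l n].
- split=> [u a v w|w a u v]; congr pair => /=.
  + exact: (vo_bilinear voY n).1.
  + rewrite (vo_bilinear voY n).1 (vo_bilinear voY n).1 (def_bilinear n).1.
    by rewrite !scalerDr [LHS](AC (2*2*2) (1*3*5*(2*4*6))).
  + exact: (vo_bilinear voY n).2.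
  + rewrite [Y _ n w.2](vo_bilinear voY n).2 [Y _ n w.1](vo_bilinear voY n).2.
    rewrite [Y1 _ n w.1](def_bilinear n).2.
    by rewrite !scalerDr [LHS](AC (2*2*2) (1*3*5*(2*4*6))).
- have [N1 H1] := vo_commutator voY u.1 v.1 w.1 m n.
  have [N2 H2] := vo_commutator voY u.1 v.1 w.2 m n.
  have [N3 H3] := vo_commutator voY u.1 v.2 w.1 m n.
  have [N4 H4] := vo_commutator voY u.2 v.1 w.1 m n.
  have [N5 H5] := def_commutator u.1 v.1 w.1 m n.
  (* The formulas hold for all large [N], so the five sums can be given a common range and added
     termwise. *)
  exists (N1 + N2 + N3 + N4 + N5)%N => N leN.
  rewrite pair_sum; congr pair => /=; first by apply: H1; lia.
  rewrite !(voDr voY) commS (H2 N) ?(H3 N) ?(H4 N) ?(H5 N); try lia.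
  rewrite -!big_split /=; apply: eq_bigr => i _.
  by rewrite -!scalerDr !(voDl voY) (AC (3*2) (1*(2*3*5)*4)).
have [N1 H1] := vo_iterate voY u.1 v.1 w.1 l n.
have [N2 H2] := vo_iterate voY u.1 v.1 w.2 l n.
have [N3 H3] := vo_iterate voY u.1 v.2 w.1 l n.
have [N4 H4] := vo_iterate voY u.2 v.1 w.1 l n.
have [N5 H5] := def_iterate u.1 v.1 w.1 l n.
exists (N1 + N2 + N3 + N4 + N5)%N => N leN.
rewrite !pair_sum; congr pair => /=; first by apply: H1; lia.
rewrite !(voDl voY) (AC (1*3*1) (1*2*3*(5*4))) /=.
rewrite (H2 N) ?(H3 N) ?(H4 N) ?(H5 N); try lia.
rewrite -!sumrB -!big_split /=; apply: eq_bigr => i _.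
by rewrite !(voDr voY) !scalerDr commS.
Qed.

End DualNumbers.

(** * Homogeneous components *)

Section Grading.
Variables (C : fieldType) (V : vertexAlgebra C).
Implicit Types (u v w : V) (n m : int).

Lemma hom_subspace n : subspace (hom V n).
Proof. exact: (va_grading V).1. Qed.

Lemma hom0 n : hom V n 0.
Proof. exact: (hom_subspace n).1. Qed.

Lemma homZ n a v : hom V n v -> hom V n (a *: v).
Proof. by move=> vn; rewrite -[_ *: _]addr0; apply: (hom_subspace n).2 => //; exact: hom0. Qed.

Lemma homD n u v : hom V n u -> hom V n v -> hom V n (u + v).
Proof. by move=> un vn; rewrite -[u]scale1r; apply: (hom_subspace n).2. Qed.

Definition components v : int -> V := sval (cid ((va_grading V).2 v)).

Definition component n v := components v n.

Lemma componentP v : [/\ forall n, hom V n (component n v),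
  finite_set [set n | component n v <> 0] & v = \sum_(n \in [set: int]) component n v].
Proof. by rewrite /component /components; case: cid => d []. Qed.

Lemma component_hom v n : hom V n (component n v).
Proof. by have [] := componentP v. Qed.

Lemma component_unique v (d : int -> V) (s : seq int) : uniq s ->
  (forall n, hom V n (d n)) -> (forall n, n \notin s -> d n = 0) ->
  v = \sum_(n <- s) d n -> components v = d.
Proof.
move=> us dn ds vE; rewrite /components; case: cid => d' [_ /= uniq_d]; apply: uniq_d.
split=> //.
  apply: (sub_finite_set (B := [set` s])); last exact: finite_seq.
  by move=> n /= dn0; apply: contrapT => /negP/ds.
rewrite vE [LHS]fsbig_seq //; apply: fsbig_widen => // n [_ /= /negP].
exact: ds.
Qed.

Lemma component_sum v (s : seq int) : uniq s ->
  (forall n, n \notin s -> component n v = 0) -> v = \sum_(n <- s) component n v.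
Proof.
move=> us s0; have [_ _ vE] := componentP v.
rewrite {1}vE [RHS]fsbig_seq //; apply/esym/fsbig_widen => // n [_ /= /negP].
exact: s0.
Qed.

Lemma component_support v :
  exists2 s : seq int, uniq s & forall n, n \notin s -> component n v = 0.
Proof.
have [_ /finite_seqP[s sE] _] := componentP v; exists (undup s); first exact: undup_uniq.
move=> n; rewrite mem_undup => /negP ns; apply: contrapT => vn; apply: ns.
by have : [set n | component n v <> 0] n by []; rewrite sE.
Qed.

Lemma component_id n v : hom V n v -> component n v = v.
Proof.
move=> vn; rewrite /component (@component_unique v (fun m => if m == n then v else 0) [:: n]) ?eqxx //.
- by move=> m; case: eqP => [->|_] //; exact: hom0.
- by move=> m; rewrite inE => /negPf ->.
by rewrite big_seq1 eqxx.
Qed.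

Lemma component_neq m n v : hom V m v -> m != n -> component n v = 0.
Proof.
move=> vm mn; rewrite /component (@component_unique v (fun i => if i == m then v else 0) [:: m]).
- by rewrite eq_sym (negPf mn).
- by [].
- by move=> i; case: eqP => [->|_] //; exact: hom0.
- by move=> i; rewrite inE => /negPf ->.
by rewrite big_seq1 eqxx.
Qed.

Lemma component_is_linear n : linear (component n).
Proof.
move=> a u v; have [s us s0] := component_support u; have [t ut t0] := component_support v.
have st0 m : m \notin undup (s ++ t) -> m \notin s /\ m \notin t.
  by rewrite mem_undup mem_cat negb_or => /andP.
rewrite /component (@component_unique (a *: u + v) (fun n => a *: component n u + component n v)
  (undup (s ++ t))) //.
- exact: undup_uniq.
- by move=> m; apply: homD; [apply: homZ|]; exact: component_hom.
- by move=> m /st0[/s0 -> /t0 ->]; rewrite scaler0 addr0.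
rewrite big_split /= -scaler_sumr -!component_sum ?undup_uniq //.
  by move=> m /st0[_ /t0].
by move=> m /st0[/s0].
Qed.

HB.instance Definition _ n := GRing.isLinear.Build C V V _ (component n) (component_is_linear n).

Lemma componentZ n a v : component n (a *: v) = a *: component n v.
Proof. exact: linearZ. Qed.

Lemma componentD n u v : component n (u + v) = component n u + component n v.
Proof. exact: linearD. Qed.

Lemma component0 n : component n 0 = 0.
Proof. exact: linear0. Qed.

End Grading.

Lemma component_shift (C : fieldType) (V W : vertexAlgebra C) (f : V -> W) d :
  linear f -> (forall n v, hom V n v -> hom W (n + d) (f v)) ->
  forall n v, component (n + d) (f v) = f (component n v).
Proof.
move=> fl fh n v.
have [s us s0] := component_support v.
have fs0 : (if n \in s then f (component n v) else 0) = f (component n v).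
  by case: ifPn => // /s0 ->; rewrite (linear_fun0 fl).
rewrite -fs0 [v in LHS](component_sum us s0) (linear_fun_sum fl) linear_sum /=.
case: ifPn => ns; last first.
  rewrite big_seq big1 // => m ms; apply: (@component_neq _ _ (m + d)).
    by apply: fh; exact: component_hom.
  by apply: contraNneq ns => /addIr <-.
rewrite (bigD1_seq n) //= big1 => [|m mn].
  by rewrite addr0 component_id //; apply: fh; exact: component_hom.
apply: (@component_neq _ _ (m + d)); first by apply: fh; exact: component_hom.
by apply: contraNneq mn => /addIr ->.
Qed.

Lemma mode_component (C : fieldType) (V : vertexAlgebra C) (u v : V) p m n : hom V p u ->
  component m (Y u n v) = Y u n (component (m + n + 1 - p) v).
Proof.
move=> up; rewrite -(@component_shift _ _ _ (Y u n) (p - n - 1)).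
- by congr component; ring.
- exact: (vo_bilinear (va_vertex_operator V) n).1.
by move=> q w wq; rewrite addrC; apply: va_weight.
Qed.

(** * Algebras generated in weight one, and their radical *)

Section Generated.
Variables (C : numFieldType) (g : lieAlgebra C) (V : vertexAlgebra C) (iota : g -> V).
Let voY := va_vertex_operator V.

Definition generated := forall P : V -> Prop, subspace P -> P (vac V) ->
  (forall a n v, (0 < n)%N -> P v -> P (Y (iota a) (- n%:Z) v)) -> forall v, P v.

Hypothesis gen : generated.
Hypothesis iota_lin : linear iota.
Hypothesis iota1 : forall a, hom V 1 (iota a).

(** The mode a(-n) raises weights by n > 0, so weight zero comes only from the vacuum, and weight
    one only from a(-1) applied to it. *)
Lemma low_weights v : [/\ forall n, n < 0 -> component n v = 0,
  exists c, component 0 v = c *: vac V & exists a, component 1 v = iota a].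
Proof.
have iota0 := linear_fun0 iota_lin.
move: v; apply: gen.
- split=> [|a u v [u1 [c uc] [x ux]] [v1 [d vd] [y vy]]].
    split=> [n _||]; rewrite ?component0 //; first by exists 0; rewrite scale0r.
    by exists 0.
  split=> [n n0||].
  + by rewrite componentD componentZ u1 // v1 // scaler0 addr0.
  + by exists (a * c + d); rewrite componentD componentZ uc vd scalerDl scalerA.
  + by exists (a *: x + y); rewrite componentD componentZ ux vy iota_lin.
- have h0 := va_vacuum_weight V; split=> [n n0||].
  + by rewrite (component_neq h0) // eq_sym lt_eqF.
  + by exists 1; rewrite component_id // scale1r.
  + by exists 0; rewrite (component_neq h0) // iota0.
move=> a n v n0 [v1 [c vc] _]; split=> [m m0||].
- by rewrite (mode_component _ _ _ (iota1 a)) v1 ?(vo0r voY) //; lia.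
- exists 0; rewrite (mode_component _ _ _ (iota1 a)) v1 ?(vo0r voY) ?scale0r //; lia.
rewrite (mode_component _ _ _ (iota1 a)); case: (ltnP 1 n) => n1.
  by exists 0; rewrite v1 ?(vo0r voY) ?iota0 //; lia.
have -> : n = 1%N by lia.
exists (c *: a); have -> : 1 - 1%:Z + 1 - 1 = 0 by lia.
rewrite vc (voZr voY) (va_creation (iota a)).2.
by rewrite (linear_funZ iota_lin).
Qed.

Lemma hom_lt0 n v : n < 0 -> hom V n v -> v = 0.
Proof. by move=> n0 vn; have [/(_ n n0)] := low_weights v; rewrite component_id. Qed.

Lemma hom_0 v : hom V 0 v -> exists c, v = c *: vac V.
Proof. by move=> v0; have [_ + _] := low_weights v; rewrite component_id. Qed.

Lemma hom_1 v : hom V 1 v -> exists a, v = iota a.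
Proof. by move=> v1; have [_ _] := low_weights v; rewrite component_id. Qed.

(** Modes of either sign occur here, unlike in [monomial]. *)
Definition mode_word (s : seq (g * int)) (v : V) : V :=
  foldr (fun p w => Y (iota p.1) p.2 w) v s.

Lemma mode_word_linear s : linear (mode_word s).
Proof.
move=> a u v; elim: s => //= p s ->.
by rewrite (voDr voY) (voZr voY).
Qed.

(* For an affine vertex algebra this is the maximal proper graded ideal. *)
Definition radical (v : V) := forall s, component 0 (mode_word s v) = 0.

Lemma radical_subspace : subspace radical.
Proof.
split=> [s|a u v uJ vJ s].
  by rewrite (linear_fun0 (mode_word_linear s)) component0.
by rewrite mode_word_linear componentD componentZ uJ vJ scaler0 addr0.
Qed.

Lemma radicalZ a v : radical v -> radical (a *: v).
Proof.
move=> vJ; rewrite -[_ *: _]addr0; apply: radical_subspace.2 => //.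
exact: radical_subspace.1.
Qed.

Lemma radicalD u v : radical u -> radical v -> radical (u + v).
Proof. by move=> uJ vJ; rewrite -[u]scale1r; apply: radical_subspace.2. Qed.

Lemma radicalB u v : radical u -> radical v -> radical (u - v).
Proof. by move=> uJ vJ; rewrite -scaleN1r; apply: radicalD => //; exact: radicalZ. Qed.

Lemma radical_sum I (r : seq I) (F : I -> V) :
  (forall i, radical (F i)) -> radical (\sum_(i <- r) F i).
Proof.
move=> FJ; apply: (big_ind radical) => //; first exact: radical_subspace.1.
exact: radicalD.
Qed.

Lemma radical_mode a n v : radical v -> radical (Y (iota a) n v).
Proof.
by move=> vJ s; have := vJ (rcons s (a, n)); rewrite /mode_word foldr_rcons.
Qed.

Lemma mode_word_component s v n :
  component n (mode_word s v) = mode_word s (component (n + \sum_(p <- s) p.2) v).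
Proof.
elim: s n => [|p s IH] n /=; first by rewrite big_nil addr0.
rewrite (mode_component _ _ _ (iota1 p.1)) IH big_cons; congr (Y _ _ (mode_word _ (component _ _))).
by ring.
Qed.

Lemma radical_component n v : radical v -> radical (component n v).
Proof.
move=> vJ s; rewrite mode_word_component add0r.
have [nS|nS] := eqVneq n (\sum_(p <- s) p.2).
  rewrite -nS (component_id (component_hom _ _)) nS.
  by have := vJ s; rewrite mode_word_component add0r.
rewrite (component_neq (component_hom _ _) nS).
exact: linear_fun0 (mode_word_linear s).
Qed.

Lemma radical_left u n v : radical v -> radical (Y u n v).
Proof.
move: n v; move: u; apply: gen => [|n v vJ|a m u m0 uJ n v vJ].
- split=> [n v _|a u u' uJ uJ' n v vJ].
    by rewrite (vo0l voY); exact: radical_subspace.1.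
  by rewrite (voDl voY) (voZl voY); apply: radical_subspace.2; [exact: uJ | exact: uJ'].
- by rewrite va_vacuum; case: ifP => _ //; exact: radical_subspace.1.
have [N0 /(_ N0 (leqnn _)) ->] := vo_iterate voY (iota a) u v (- m%:Z) n.
apply: radicalB; apply: radical_sum => i; apply: radicalZ.
  by apply: radical_mode; exact: uJ.
by apply: uJ; exact: radical_mode.
Qed.

(** D moves to the left of a word at the cost of terms - n a(n - 1), which are again modes; at the
    left end it meets the component of weight -1, which is zero. *)
Lemma radical_D v : radical v -> radical (D v).
Proof.
move=> vJ s; elim/last_ind: s v vJ => [|s [a n] IH] v vJ /=.
  have -> : component 0 (D v) = D (component (-1) v).
    have Dl : linear (@D C V) by move=> c u w; rewrite /D (voDl voY) (voZl voY).
    rewrite -(@component_shift _ _ _ (@D C V) 1) // => m w wm.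
    have -> : m + 1 = m - (-2) - 1 + 0 by ring.
    by apply: va_weight => //; exact: va_vacuum_weight.
  have [/(_ (-1) isT) -> _ _] := low_weights v.
  by rewrite /D (vo0l voY).
rewrite /mode_word foldr_rcons /= -/(mode_word s _).
have [DY YD] := va_derivative (iota a) v n.
have -> : Y (iota a) n (D v) = D (Y (iota a) n v) - (- n)%:~R *: Y (iota a) (n - 1) v.
  by rewrite -YD -DY subKr.
rewrite (linear_funB (mode_word_linear s)) linearB /= IH; last exact: radical_mode.
by rewrite (radicalZ _ (radical_mode _ _ vJ)) subr0.
Qed.

(** Induction on [u] through the commutator formula. On the vacuum, v_(-j-2) 1 is (D v)_(-j-1) 1
    divided by j + 1, which reduces to [radical_D]. *)
Lemma radical_right u n v : radical v -> radical (Y v n u).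
Proof.
move: n v; move: u; apply: gen => [|n v vJ|a m u m0 uJ n v vJ].
- split=> [n v _|a u u' uJ uJ' n v vJ].
    by rewrite (vo0r voY); exact: radical_subspace.1.
  by rewrite (voDr voY) (voZr voY); apply: radical_subspace.2; [exact: uJ | exact: uJ'].
- have [v0 v1] := va_creation v.
  case: (lerP 0 n) => n0; first by rewrite v0 //; exact: radical_subspace.1.
  have -> : n = - (`|n|.-1.+1)%:Z by lia.
  elim: (`|n|.-1)%N v vJ {v0 v1} => [|j IH] v vJ.
    by have [_ ->] := va_creation v.
  have [_ YD] := va_derivative v (vac V) (- j.+1%:Z).
  have jj : j.+1%:R != 0 :> C by rewrite pnatr_eq0.
  have -> : Y v (- j.+2%:Z) (vac V) = j.+1%:R^-1 *: Y (D v) (- j.+1%:Z) (vac V).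
    rewrite YD opprK scalerA mulVf // scale1r; congr Y; lia.
  by apply: radicalZ; apply: IH; exact: radical_D.
have [N0 H] := vo_commutator voY (iota a) v u (- m%:Z) n.
have -> : Y v n (Y (iota a) (- m%:Z) u) = Y (iota a) (- m%:Z) (Y v n u)
    - (Y (iota a) (- m%:Z) (Y v n u) - Y v n (Y (iota a) (- m%:Z) u)) by rewrite subKr.
rewrite (H N0) //; apply: radicalB; first by apply: radical_mode; exact: uJ.
apply: radical_sum => i; apply: radicalZ; apply: uJ; exact: radical_mode.
Qed.

Lemma radical_proper_graded_ideal : vac V <> 0 -> proper_graded_ideal radical.
Proof.
move=> v0; split.
  split=> [|u v n vJ|v vJ].
  - exact: radical_subspace.
  - by split; [exact: radical_left | exact: radical_right].
  have [s us s0] := component_support v; rewrite (component_sum us s0).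
  exists [seq (1, component n v) | n <- s].
    move=> _ /mapP[n _ ->] /=; split; first exact: radical_component.
    by exists n; exact: component_hom.
  by rewrite big_map; apply: eq_bigr => n _ /=; rewrite scale1r.
move=> JT; apply: v0; have : radical (vac V) by rewrite JT.
by move=> /(_ [::]) /=; rewrite component_id //; exact: va_vacuum_weight.
Qed.

End Generated.

(** * Affine vertex algebras *)

Section SimpleAffine.
Variables (C : numFieldType) (g : lieAlgebra C) (form : g -> g -> C) (k : C).
Variables (U L : vertexAlgebra C) (iota : g -> U) (pi : U -> L).
Hypotheses (iota_lin : linear iota) (univ : universal_affine form k iota).
Hypothesis quo : simple_quotient pi.

Lemma universal_generated : generated iota.
Proof.
move=> P [P0 PD] Pv PY v; have [_ spanU _ _] := univ; have [s sP ->] := spanU v.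
elim: s sP => [|p s IH] sP; first by rewrite big_nil.
rewrite big_cons; apply: PD; last by apply: IH => q qs; apply: sP; rewrite inE qs orbT.
have [t tn ->] := sP p (mem_head _ _).
elim: t tn => [|[a n] t IHt] //= /andP[n0 tn].
by apply: PY => //; exact: IHt.
Qed.

Lemma universal_iota_hom a : hom U 1 (iota a).
Proof.
have [_ _ H _] := univ; have := H [:: (a, 1%N)] isT.
by rewrite big_cons big_nil /= /modes (va_creation _).2.
Qed.

Lemma quotient_linear : linear pi. Proof. by have [[]] := quo. Qed.

Lemma quotient_vac : pi (vac U) = vac L. Proof. by have [[]] := quo. Qed.

Lemma quotient_Y u n v : pi (Y u n v) = Y (pi u) n (pi v).
Proof. by have [[_ _ H _] _ _] := quo; exact: H. Qed.

Lemma quotient_surj w : exists v, pi v = w. Proof. by have [_ H _] := quo; exact: H. Qed.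

Lemma quotient_ideal (J : set U) : proper_graded_ideal J -> forall v, J v -> pi v = 0.
Proof. by move=> Ji v Jv; have [_ _ [_ H]] := quo; exact: H Jv. Qed.

Lemma quotient_component n v : component n (pi v) = pi (component n v).
Proof.
have [[_ _ _ ph] _ _] := quo; rewrite -[n in LHS]addr0.
apply: component_shift; first exact: quotient_linear.
by move=> m w wm; rewrite addr0; exact: ph.
Qed.

Lemma quotient_vac_neq0 : vac L <> 0.
Proof.
move=> v0; have [_ _ [[[Isub Iid _] In] _]] := quo; apply: In.
apply/seteqP; split=> // v _ /=.
rewrite -[v](va_creation v).2; apply: (Iid v (vac U) (-1) _).1.
by rewrite /= quotient_vac.
Qed.

Lemma universal_vac_neq0 : vac U <> 0.
Proof.
move=> v0; apply: quotient_vac_neq0.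
by rewrite -quotient_vac v0 (linear_fun0 quotient_linear).
Qed.

Definition quo_iota a : L := pi (iota a).

Lemma quo_iota_linear : linear quo_iota.
Proof. by move=> a x y; rewrite /quo_iota iota_lin quotient_linear. Qed.

Lemma quo_iota_hom a : hom L 1 (quo_iota a).
Proof. by have [[_ _ _ ph] _ _] := quo; apply: ph; exact: universal_iota_hom. Qed.

Lemma quo_generated : generated quo_iota.
Proof.
move=> P [P0 PD] Pv PY w; have [v <-] := quotient_surj w; move: v.
apply: universal_generated => [||a n v n0 Pv'].
- split=> [|a u v Pu Pv']; first by rewrite (linear_fun0 quotient_linear).
  by rewrite quotient_linear; exact: PD.
- by rewrite quotient_vac.
by rewrite quotient_Y; exact: PY.
Qed.

Lemma quo_affine_module : affine_module form k (modes quo_iota).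
Proof.
have [[[_ act] _] _ _ _] := univ; split.
  move=> n; split=> [a|w] c x y; rewrite /modes.
    exact: (vo_bilinear (va_vertex_operator L) n).1.
  by rewrite quo_iota_linear (vo_bilinear (va_vertex_operator L) n).2.
move=> a b m n w; have [v <-] := quotient_surj w.
rewrite /modes -!quotient_Y -(linear_funB quotient_linear) -/(modes iota a m _).
rewrite -/(modes iota b n _) act (linear_funD quotient_linear).
by rewrite (linear_funZ quotient_linear).
Qed.

Lemma quo_annihilated : annihilated (modes quo_iota) (vac L).
Proof.
have [[_ ann] _ _ _] := univ.
move=> a n n0; rewrite /modes -quotient_vac -quotient_Y -/(modes iota a n _) ann //.
exact: linear_fun0 quotient_linear.
Qed.

(** Maximality of the kernel of [pi] enters here. A preimage of [w] lies in the radical of [U],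
    since weight zero of [U] is spanned by the vacuum, on which [pi] is injective. *)
Lemma quo_radical_eq0 w : radical quo_iota w -> w = 0.
Proof.
have [v <-] := quotient_surj w => vJ.
apply: (quotient_ideal (radical_proper_graded_ideal universal_generated iota_lin
  universal_iota_hom universal_vac_neq0)) => s.
have [c vc] : exists c, component 0 (mode_word iota s v) = c *: vac U.
  have [] // := low_weights universal_generated iota_lin universal_iota_hom (mode_word iota s v).
have pw : pi (mode_word iota s v) = mode_word quo_iota s (pi v).
  by elim: s {vc} => //= p s IH; rewrite quotient_Y IH.
have := vJ s; rewrite -pw quotient_component vc (linear_funZ quotient_linear) quotient_vac.
move=> /eqP; rewrite scaler_eq0 => /orP[/eqP ->|/eqP /quotient_vac_neq0 //].
by rewrite scale0r.
Qed.

End SimpleAffine.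

(** * Powers of e(-1) on a vacuum vector, with an operator as central term *)

Section ModePowers.
Variables (C : numFieldType) (g : lieAlgebra C) (M : lmodType C).
Variables (act : g -> int -> M -> M) (Z : g -> g -> M -> M).
Hypothesis act_bilinear : forall n, bilinear_map (fun a w => act a n w).
Hypothesis act_comm : forall a b m n w,
  act a m (act b n w) - act b n (act a m w)
  = act (lie a b) (m + n) w + (if m + n == 0 then m%:~R *: Z a b w else 0).

Lemma act_swap a b m n w : act a m (act b n w) =
  act b n (act a m w) + act (lie a b) (m + n) w
  + (if m + n == 0 then m%:~R *: Z a b w else 0).
Proof. by rewrite -addrA -act_comm addrC subrK. Qed.

Lemma actZl c a n w : act (c *: a) n w = c *: act a n w.
Proof. exact: linear_funZ ((act_bilinear n).2 w) c a. Qed.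

Lemma actZr c a n w : act a n (c *: w) = c *: act a n w.
Proof. exact: linear_funZ ((act_bilinear n).1 a) c w. Qed.

Lemma actDr a n v w : act a n (v + w) = act a n v + act a n w.
Proof. exact: linear_funD ((act_bilinear n).1 a) v w. Qed.

Lemma act0r a n : act a n 0 = 0.
Proof. exact: linear_fun0 ((act_bilinear n).1 a). Qed.

Lemma act0l n w : act 0 n w = 0.
Proof. exact: linear_fun0 ((act_bilinear n).2 w). Qed.

Variables (e : g) (w0 : M).
Hypothesis Z_comm : forall a b n w, Z a b (act e n w) = act e n (Z a b w).
Hypothesis w0_ann : annihilated act w0.

Notation X m := (iter m (act e (-1)) w0).

Lemma mode0_power a l m : lie e (lie e a) = l *: e ->
  act (lie a e) 0 (X m) = (m%:R * l) *: X m.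
Proof.
move=> el; elim: m => [|m IH]; first by rewrite w0_ann // mul0r scale0r.
rewrite iterS act_swap IH add0r addr0 actZr.
have -> : lie (lie a e) e = l *: e by rewrite lieC (lieC a) linearN opprK.
by rewrite actZl -scalerDl -natr1 mulrDl mul1r.
Qed.

(** Each crossing of a(1) with e(-1) leaves a central term and [a, e](0), which acts on the j
    remaining factors by j l; summing j gives the binomial. The central term is an operator so that
    the level may also be a dual number. *)
Lemma mode1_power a l m : lie e (lie e a) = l *: e ->
  act a 1 (X m.+1) = m.+1%:R *: Z a e (X m) + (l * 'C(m.+1, 2)%:R) *: X m.
Proof.
move=> el; elim: m => [|m IH].
  rewrite iterS act_swap !w0_ann // act0r !add0r /= scale1r.
  by rewrite bin_small // mulr0 scale0r addr0.
rewrite iterS act_swap IH (mode0_power m.+1 el) actDr !actZr -Z_comm -!iterS /=.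
rewrite -[m.+2%:R]natr1 [in RHS]binS bin1 (natrD _ 'C(_, _)) mulrDr !scalerDl !scale1r.
by rewrite [l * m.+1%:R]mulrC [LHS](AC (2*1*1) (1*4*(2*3))).
Qed.

End ModePowers.

(** * Singular vectors and local nilpotency of e(-1) *)

Section AffineVacuum.
Variables (C : numFieldType) (g : lieAlgebra C) (form : g -> g -> C) (k : C).
Variables (V : vertexAlgebra C) (iota : g -> V).
Let voY := va_vertex_operator V.
Hypotheses (gen : generated iota) (iota_lin : linear iota).
Hypothesis iota1 : forall a, hom V 1 (iota a).
Hypothesis aff : affine_module form k (modes iota).
Hypothesis ann : annihilated (modes iota) (vac V).

Let act_bilinear := aff.1.

Lemma affine_comm a b m n w :
  modes iota a m (modes iota b n w) - modes iota b n (modes iota a m w)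
  = modes iota (lie a b) (m + n) w
    + (if m + n == 0 then m%:~R *: ((form a b * k) *: w) else 0).
Proof.
rewrite aff.2; congr (_ + _); case: ifP => _; last by rewrite scale0r.
by rewrite scalerA mulrA.
Qed.

Let swap a b m n w := act_swap affine_comm a b m n w.

(* The positive modes kill the singular vector s, so by reordering modes the
   module generated by s is spanned by the b_1(-m_1) ... b_r(-m_r) s with m_i >= 0. *)
Lemma singular_radical s d : 0 < d -> hom V d s ->
  (forall a n, 0 < n -> modes iota a n s = 0) -> radical iota s.
Proof.
move=> d0 sd sing.
pose good (P : V -> Prop) := [/\ subspace P, P s &
  forall a n v, n <= 0 -> P v -> P (modes iota a n v)].
(* The smallest subspace containing [s] and stable under all modes of degree n <= 0, with [Tmin] as
   its induction principle. *)
pose T v := forall P, good P -> P v.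
have TT : good T.
  split=> [|P [_ Ps _] //|a n v n0 Tv P gP]; last first.
    by case: (gP) => _ _; apply => //; exact: Tv.
  split=> [P [[]] //|a u v Tu Tv P gP].
  by case: (gP) => -[_ PD] _ _; apply: PD; [exact: Tu | exact: Tv].
have Tmin v : T v -> forall P, good P -> P v by [].
clearbody T; have [[T0 TD] Ts Tneg] := TT.
have TZ a v : T v -> T (a *: v) by move=> Tv; rewrite -[_ *: _]addr0; exact: TD.
have TA u v : T u -> T v -> T (u + v) by move=> Tu Tv; rewrite -[u]scale1r; exact: TD.
have Tmode v : T v -> forall a n, T (modes iota a n v).
  move=> Tv; have : T v /\ forall a n, 0 < n -> T (modes iota a n v).
    apply: (Tmin v Tv (fun v => T v /\ forall a n, 0 < n -> T (modes iota a n v))).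
    split=> [||b m w m0 [Tw Hw]].
    - split=> [|a u w [Tu Hu] [Tw Hw]].
        by split=> // a n n0; rewrite (act0r act_bilinear).
      split=> [|b n n0]; first exact: TD.
      by rewrite (actDr act_bilinear) (actZr act_bilinear); apply: TD; [exact: Hu | exact: Hw].
    - by split=> // a n n0; rewrite sing.
    split=> [|a n n0]; first exact: Tneg.
    rewrite swap; apply: (TA); last by case: ifP => // _; exact/TZ/TZ.
    apply: TA; first by apply: Tneg => //; exact: Hw.
    by case: (lerP (n + m) 0) => nm; [exact: Tneg | exact: Hw].
  by move=> [_ Hv] a n; case: (lerP n 0) => n0; [exact: Tneg | exact: Hv].
have T0c v : T v -> component 0 v = 0.
  move=> Tv; suff : forall m, m <= 0 -> component m v = 0 by apply.
  apply: (Tmin v Tv (fun v => forall m, m <= 0 -> component m v = 0)).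
  split=> [||a n w n0 Hw m m0].
  - split=> [m _|a u w Hu Hw m m0]; first exact: component0.
    by rewrite componentD componentZ Hu // Hw // scaler0 addr0.
  - by move=> m m0; apply: component_neq sd _; lia.
  by rewrite (mode_component _ _ _ (iota1 a)) Hw ?(vo0r voY) //; lia.
move=> t; apply: T0c; elim: t => //= p t IH; exact: Tmode.
Qed.

Hypothesis form_is : invariant_symmetric_form form.
Variable e : g.
Hypothesis extremal : forall a, lie e (lie e a) = - (2 * form e a) *: e.

Notation X m := (iter m (modes iota e (-1)) (vac V)).

(** With l = - 2 <e, a> the binomial term becomes - m (m + 1) <e, a>, so the level k is lowered to k
    - m; at m = k the coefficient vanishes. *)
Lemma affine_mode1_power a m : modes iota a 1 (X m.+1) =
  (m.+1%:R * form a e * (k - m%:R)) *: X m.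
Proof.
rewrite (mode1_power act_bilinear affine_comm _ ann m (extremal a)); last first.
  by move=> b c n w; rewrite (actZr act_bilinear).
rewrite scalerA -scalerDl; congr (_ *: _).
have binE : 2 * 'C(m.+1, 2)%:R = m.+1%:R * m%:R :> C.
  by rewrite -!natrM -(mul_bin_diag m.+1 1) bin1.
rewrite (formC form_is e) mulNr mulrAC binE; ring.
Qed.

(** Only n = 1 depends on the exponent. For n >= 2 every power is killed: crossing e(-1) leaves
    [a, e](n - 1), and at n = 2 this mode acts with a factor <[a, e], e> = 0. *)
Lemma affine_power_singular (K : nat) a n : k = K%:R -> 0 < n ->
  modes iota a n (X K.+1) = 0.
Proof.
move=> kK n0; case: (ltrP 1 n) => [n1|n1]; last first.
  have -> : n = 1 by lia.
  by rewrite affine_mode1_power kK subrr mulr0 scale0r.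
have lee b : form (lie b e) e = 0.
  by rewrite (form_inv form_is) lie_alternating (form0r form_is).
have -> : n = (`|n|.-2.+2)%:Z by lia.
elim: (`|n|.-2)%N a (K.+1) => [|i IH] a m.
  elim: m => [|m IHm]; first by rewrite ann.
  rewrite iterS swap IHm (act0r act_bilinear) add0r addr0.
  case: m {IHm} => [|m]; first by rewrite ann.
  by rewrite affine_mode1_power lee mulr0 mul0r scale0r.
elim: m => [|m IHm]; first by rewrite ann.
rewrite iterS swap IHm (act0r act_bilinear) add0r.
have -> : i.+3%:Z + (-1) = i.+2%:Z by lia.
by rewrite IH addr0.
Qed.

Lemma affine_power_hom m : hom V m%:Z (X m).
Proof.
elim: m => [|m IH]; first exact: va_vacuum_weight.
rewrite iterS; have -> : m.+1%:Z = 1 - (-1) - 1 + m%:Z by lia.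
exact: va_weight.
Qed.

Lemma affine_power_radical (K : nat) : k = K%:R -> radical iota (X K.+1).
Proof.
move=> kK; apply: (singular_radical (d := K.+1)) => //; first exact: affine_power_hom.
by move=> a n n0; exact: affine_power_singular.
Qed.

(** f(1) takes the (m + 1)-st power to (m + 1)(K - m) times the m-th, a non-zero factor for m <
    K. *)
Lemma affine_power_neq0 (f : g) (K m : nat) : vac V <> 0 -> k = K%:R ->
  form f e = 1 -> (m <= K)%N -> X m <> 0.
Proof.
move=> v0 kK fe; elim: m => [|m IH] // mK Xm.
apply: IH; first exact: ltnW.
have := affine_mode1_power f m; rewrite Xm (act0r act_bilinear) fe kK mulr1 => /esym/eqP.
rewrite -natrB ?(ltnW mK) // -natrM scaler_eq0 pnatr_eq0 muln_eq0 subn_eq0 leqNgt mK /=.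
by move/eqP.
Qed.

(** Nilpotency passes from [v] to a(m) v because ad e is nilpotent: (ad e)^3 = 0, as <e, [e, a]> =
    0. The outer induction is on p with (ad e)^p a = 0, the inner one on n with e(-1)^n v = 0. *)
Lemma affine_power_locally_nilpotent n0 : X n0 = 0 ->
  forall v, exists n, iter n (modes iota e (-1)) v = 0.
Proof.
move=> Xn; set E := modes iota e (-1).
have EL n : linear (iter n E).
  move=> a u v; elim: n => //= n ->.
  by rewrite /E (actDr act_bilinear) (actZr act_bilinear).
have iterZ n m v : iter n E v = 0 -> iter (m + n) E v = 0.
  by move=> vn; rewrite iterD vn (linear_fun0 (EL m)).
pose N v := exists n, iter n E v = 0.
have N0 : N 0 by exists 0%N.
have ND a u v : N u -> N v -> N (a *: u + v).
  move=> [m um] [n vn]; exists (m + n)%N.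
  by rewrite EL (iterZ _ m _ vn) addnC (iterZ _ n _ um) scaler0 addr0.
have NA u v : N u -> N v -> N (u + v) by move=> Nu Nv; rewrite -[u]scale1r; exact: ND.
have NZ a u : N u -> N (a *: u) by move=> Nu; rewrite -[_ *: _]addr0; exact: ND.
have NS v : N (E v) -> N v by move=> [n vn]; exists n.+1; rewrite iterSr.
suff Nmode p : forall a m v, iter p (lie e) a = 0 -> N v -> N (modes iota a m v).
  move=> v; apply: (gen (P := N)) => // [|a n w n_gt0 Nw]; first by exists n0.
  apply: (Nmode 3%N) => //=; rewrite extremal -(form_inv form_is).
  by rewrite lie_alternating (form0l form_is) mulr0 oppr0 scale0r.
elim: p => [|p IHp] a m v /=.
  by move=> -> Nv; rewrite (act0l act_bilinear).
move=> ap Nv; have [n vn] := Nv.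
elim: n v Nv vn => [|n IHn] v Nv vn; first by rewrite [v]vn (act0r act_bilinear).
(* e(-1) a(m) v is a(m) e(-1) v, with smaller n, plus [e, a](m - 1) v, with smaller p, plus a
   multiple of v. *)
apply: NS; rewrite /E swap; apply: (NA); last by case: ifP => // _; exact/NZ/NZ.
apply: NA; last by apply: IHp => //; rewrite -iterSr.
apply: IHn; last by rewrite -iterSr.
by have [i vi] := Nv; exists i; rewrite -iterSr iterS vi /E (act0r act_bilinear).
Qed.

End AffineVacuum.

(** * First-order deformations *)

Section WeightOne.
Variables (C : numFieldType) (g : lieAlgebra C) (form : g -> g -> C) (k : C).
Variables (V : vertexAlgebra C) (iota : g -> V).
Let voY := va_vertex_operator V.
Hypotheses (gen : generated iota) (iota_lin : linear iota).
Hypothesis iota1 : forall a, hom V 1 (iota a).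
Hypothesis aff : affine_module form k (modes iota).

Lemma iota_mode0 a b : Y (iota a) 0 (iota b) = iota (lie a b).
Proof.
have := aff.2 a b 0 (-1) (vac V); rewrite /modes !(va_creation _).2 /= scale0r addr0 => <-.
by rewrite (va_creation (iota a)).1 // (vo0r voY) subr0.
Qed.

Lemma iota_mode1 a b : Y (iota a) 1 (iota b) = (form a b * k) *: vac V.
Proof.
have := aff.2 a b 1 (-1) (vac V); rewrite /modes !(va_creation _).2.
rewrite (va_creation (iota a)).1 // (vo0r voY) subr0 => ->.
by rewrite /= (va_creation _).1 // add0r mul1r.
Qed.

Variable Y1 : V -> int -> V -> V.
Hypothesis dY : first_order_deformation Y1.
Notation DY := (dualY Y1).
Let voW := dualY_vertex_operator dY.

Definition dual_hom n (x : V * V) := hom V n x.1 /\ hom V n x.2.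

Lemma dualY_hom p q n x y : dual_hom p x -> dual_hom q y ->
  dual_hom (p - n - 1 + q) (DY x n y).
Proof.
move=> [x1 x2] [y1 y2]; have [_ Yw _ _ _] := dY; split; first exact: va_weight.
apply: homD; last exact: Yw.
by apply: homD; exact: va_weight.
Qed.

Lemma dual_hom_lt0 n x : n < 0 -> dual_hom n x -> x = 0.
Proof.
case: x => x1 x2 n0 [/= h1 h2].
by rewrite (hom_lt0 gen iota_lin iota1 n0 h1) (hom_lt0 gen iota_lin iota1 n0 h2).
Qed.

Definition dual_one : V * V := (vac V, 0).

(* Multiplication by p + t q. *)
Definition dual_scale (p q : C) (z : V * V) : V * V := (p *: z.1, p *: z.2 + q *: z.1).

Lemma dual_hom_0 x : dual_hom 0 x -> exists p q, x = dual_scale p q dual_one.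
Proof.
case: x => x1 x2 [/= h1 h2].
have [p ->] := hom_0 gen iota_lin iota1 h1; have [q ->] := hom_0 gen iota_lin iota1 h2.
by exists p, q; rewrite /dual_scale /= scaler0 add0r.
Qed.

Lemma dualY_creation x : (forall n, 0 <= n -> DY x n dual_one = 0) /\
  DY x (-1) dual_one = x.
Proof.
have [_ _ Yv _ _] := dY; split=> [n n0|]; rewrite /dualY /= (vo0r voY) (Yv _ _).2 add0r addr0.
  by rewrite !(va_creation _).1.
by rewrite !(va_creation _).2; case: x.
Qed.

Lemma dualY_scale_one p q n z :
  DY (dual_scale p q dual_one) n z = if n == -1 then dual_scale p q z else 0.
Proof.
have [_ _ Yv _ _] := dY.
have Y1v c m w : Y1 (c *: vac V) m w = 0.
  have := (def_bilinear dY m).2 w c (vac V) 0.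
  by rewrite /= !addr0 (Yv _ _).1 (Y10l dY) scaler0 addr0.
rewrite /dualY /dual_scale /= scaler0 add0r Y1v addr0 !(voZl voY) !va_vacuum.
by case: ifP => // _; rewrite !scaler0 addr0.
Qed.

Lemma dual_quadratic x y i : dual_hom 1 x -> dual_hom 1 y -> 2 <= i -> DY x i y = 0.
Proof.
move=> x1 y1 i2; apply: (@dual_hom_lt0 (1 - i - 1 + 1)); first by lia.
exact: dualY_hom.
Qed.

Lemma dual_mode1 x y : dual_hom 1 x -> dual_hom 1 y ->
  exists p q, DY x 1 y = dual_scale p q dual_one.
Proof.
move=> x1 y1; apply: dual_hom_0.
exact: (@dualY_hom 1 1 1).
Qed.

(** The commutator of y_(-1) and x_0 is applied to the vacuum; its term in y_1 x drops out, this
    being a dual number times the vacuum, whose mode -2 is zero. *)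
Lemma dual_skew x y : dual_hom 1 x -> dual_hom 1 y -> DY x 0 y = - DY y 0 x.
Proof.
move=> x1 y1.
have := vo_commutator_quadratic voW dual_one (-1) 0
  (fun i => dual_quadratic (i := i) y1 x1).
have [p [q ->]] := dual_mode1 y1 x1.
rewrite (dualY_creation x).1 // (vo0r voW) !(dualY_creation _).2 dualY_scale_one.
by rewrite /= scaler0 addr0 sub0r => <-; rewrite opprK.
Qed.

Lemma dual_derivation x y z : dual_hom 1 x -> dual_hom 1 y ->
  DY x 0 (DY y 0 z) = DY (DY x 0 y) 0 z + DY y 0 (DY x 0 z).
Proof.
move=> x1 y1.
have := vo_commutator_quadratic voW z 0 0 (fun i => dual_quadratic (i := i) x1 y1).
by rewrite scale0r !addr0 => <-; rewrite subrK.
Qed.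

Lemma dual_affine x y m n z p q : dual_hom 1 x -> dual_hom 1 y ->
  DY x 1 y = dual_scale p q dual_one ->
  DY x m (DY y n z) - DY y n (DY x m z)
  = DY (DY x 0 y) (m + n) z + (if m + n == 0 then m%:~R *: dual_scale p q z else 0).
Proof.
move=> x1 y1 xy.
rewrite (vo_commutator_quadratic voW z m n (fun i => dual_quadratic (i := i) x1 y1)).
rewrite xy dualY_scale_one; congr (_ + _).
have -> : (m + n - 1 == -1) = (m + n == 0) by lia.
by case: ifP => // _; rewrite scaler0.
Qed.

End WeightOne.

(** * Corrected generators and rigidity of the level *)

Section Rigidity.
Variables (C : numClosedFieldType) (g : lieAlgebra C) (form : g -> g -> C) (K : nat).
Variables (V : vertexAlgebra C) (iota : g -> V).
Let voY := va_vertex_operator V.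
Hypotheses (gen : generated iota) (iota_lin : linear iota).
Hypothesis iota1 : forall a, hom V 1 (iota a).
Hypothesis aff : affine_module form K%:R (modes iota).
Hypothesis ann : annihilated (modes iota) (vac V).
Hypothesis vac0 : vac V <> 0.
Hypothesis rad : forall v, radical iota v -> v = 0.
Hypothesis K_gt0 : (0 < K)%N.
Hypothesis gs : simple_lie g.
Hypothesis killing0 : exists x y : g, killing x y <> 0.
Hypothesis form_is : invariant_symmetric_form form.
Variables e f : g.
Hypothesis form_fe : form f e = 1.
Hypothesis extremal : forall a, lie e (lie e a) = - (2 * form e a) *: e.
Variable Y1 : V -> int -> V -> V.
Hypothesis dY : first_order_deformation Y1.
Notation DY := (dualY Y1).
Notation one := (dual_one V).
Let voW := dualY_vertex_operator dY.

(** The kernel is an ideal, and it is not g because e(-1) 1 <> 0 at level K >= 1. Cocycle identities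
    can thus be read off inside V. *)
Lemma iota_eq0 a : iota a = 0 -> a = 0.
Proof.
move=> a0; have [||H|H] := @simple_ideal _ _ gs (fun a => iota a = 0).
- split=> [|c x y x0 y0]; first exact: linear_fun0.
  by rewrite iota_lin x0 y0 scaler0 addr0.
- by move=> x y y0; rewrite -(iota_mode0 aff) ?y0 ?(vo0r voY).
- exact: H.
have [] := affine_power_neq0 aff ann form_is extremal vac0 erefl form_fe K_gt0.
by rewrite /= /modes H (vo0l voY).
Qed.

Lemma iota_inj : injective iota.
Proof.
move=> a b ab; apply/eqP; rewrite -subr_eq0; apply/eqP/iota_eq0.
by rewrite (linear_funB iota_lin) ab subrr.
Qed.

Definition dual_iota (a a' : g) : V * V := (iota a, iota a').

Lemma dual_iota_hom a a' : dual_hom 1 (dual_iota a a').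
Proof. by split; exact: iota1. Qed.

(** The antisymmetry and the cocycle identity of [psi] are the t-parts of [dual_skew] and
    [dual_derivation] on uncorrected generators. *)
Lemma dual_iota_corrected : exists2 phi : g -> g, linear phi &
  forall a b, DY (dual_iota a (phi a)) 0 (dual_iota b (phi b)) =
    dual_iota (lie a b) (phi (lie a b)).
Proof.
have [_ Yw _ _ _] := dY.
have psiP a b : exists c, Y1 (iota a) 0 (iota b) = iota c.
  apply: (hom_1 gen iota_lin iota1).
  exact: (Yw 1 1 0 _ _ (iota1 a) (iota1 b)).
pose psi a b := sval (cid (psiP a b)).
have psiE a b : Y1 (iota a) 0 (iota b) = iota (psi a b) by rewrite /psi; case: cid.
have DE a a' b b' : DY (dual_iota a a') 0 (dual_iota b b') =
    dual_iota (lie a b) (lie a b' + lie a' b + psi a b).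
  by rewrite /dualY /= !(iota_mode0 aff) // psiE /dual_iota !(linear_funD iota_lin).
have iota0 := linear_fun0 iota_lin.
have D0 a b : DY (dual_iota a 0) 0 (dual_iota b 0) = dual_iota (lie a b) (psi a b).
  by rewrite DE linear0 lie0l !add0r.
have [|||phi phil phiE] := @adjoint_cocycle_coboundary _ _ gs killing0 psi.
- split=> [a c x y|b c x y]; apply: iota_inj; rewrite -psiE iota_lin.
    by rewrite (def_bilinear dY 0).1 !psiE iota_lin.
  by rewrite (def_bilinear dY 0).2 !psiE iota_lin.
- move=> a b; apply: iota_inj.
  have := dual_skew gen iota_lin iota1 dY (dual_iota_hom a 0) (dual_iota_hom b 0).
  by rewrite !D0 => /(congr1 snd) /= ->; rewrite (linear_funN iota_lin).
- move=> x y z; apply: iota_inj.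
  have := dual_derivation gen iota_lin iota1 dY (dual_iota z 0)
    (dual_iota_hom x 0) (dual_iota_hom y 0).
  rewrite !D0 !DE => /(congr1 snd) /=.
  by rewrite !linear0 !lie0l !addr0 !add0r -(linear_funD iota_lin).
(* A correction phi' adds [a, phi' b] + [phi' a, b] to [psi a b], so the cochain bounding [psi]
   enters with a minus sign. *)
exists (fun a => - phi a) => [c x y|a b].
  by rewrite phil opprD scalerN.
rewrite DE phiE linearN /= lieNl; congr dual_iota.
by rewrite -opprD [lie a (phi b) + _]addrC addrA addNr sub0r.
Qed.

Variable phi : g -> g.
Hypothesis phi_lin : linear phi.
Notation gamma a := (dual_iota a (phi a)).
Hypothesis gammaE : forall a b, DY (gamma a) 0 (gamma b) = gamma (lie a b).

Lemma gamma_linear : linear (fun a => gamma a).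
Proof.
by move=> c x y; rewrite /dual_iota phi_lin !iota_lin.
Qed.

Lemma vac_scaler_inj : injective (fun c : C => c *: vac V).
Proof.
move=> c c' /= /eqP; rewrite -subr_eq0 -scalerBl scaler_eq0 subr_eq0.
by move=> /orP[/eqP //|/eqP /vac0].
Qed.

Lemma dual_scale_one_inj p q p' q' :
  dual_scale p q one = dual_scale p' q' one -> p = p' /\ q = q'.
Proof.
rewrite /dual_scale /= !scaler0 !add0r => -[pp qq].
by split; exact: vac_scaler_inj.
Qed.

Lemma level_exists : exists q : g -> g -> C, forall a b,
  DY (gamma a) 1 (gamma b) = dual_scale (form a b * K%:R) (q a b) one.
Proof.
have H a b : exists q, DY (gamma a) 1 (gamma b) = dual_scale (form a b * K%:R) q one.
  have [p [q pq]] := dual_mode1 gen iota_lin iota1 dY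
    (dual_iota_hom a (phi a)) (dual_iota_hom b (phi b)).
  exists q; rewrite pq; congr dual_scale.
  have := congr1 fst pq; rewrite /= (iota_mode1 aff); by move/vac_scaler_inj.
by exists (fun a b => sval (cid (H a b))) => a b; case: cid.
Qed.

Variable q : g -> g -> C.
Hypothesis qE : forall a b,
  DY (gamma a) 1 (gamma b) = dual_scale (form a b * K%:R) (q a b) one.

Lemma gamma_comm a b m n z :
  DY (gamma a) m (DY (gamma b) n z) - DY (gamma b) n (DY (gamma a) m z)
  = DY (gamma (lie a b)) (m + n) z +
    (if m + n == 0 then m%:~R *: dual_scale (form a b * K%:R) (q a b) z else 0).
Proof.
rewrite (dual_affine gen iota_lin iota1 dY _ _ _
  (dual_iota_hom _ _) (dual_iota_hom _ _) (qE a b)).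
by rewrite gammaE.
Qed.

Lemma gamma_bilinear n : bilinear_map (fun a z => DY (gamma a) n z).
Proof.
split=> [a|z] c x y; first exact: (vo_bilinear voW n).1.
by rewrite gamma_linear (vo_bilinear voW n).2.
Qed.

Lemma dualY_scale p r x n z : DY x n (dual_scale p r z) = dual_scale p r (DY x n z).
Proof.
rewrite /dualY /dual_scale /= (voDr voY) !(voZr voY).
have -> : Y1 x.1 n (p *: z.1) = p *: Y1 x.1 n z.1.
  exact: linear_funZ ((def_bilinear dY n).1 x.1) p z.1.
by rewrite !scalerDr [in LHS](AC (2*1*1) (1*3*4*2)).
Qed.

Lemma dual_scale0 p r : dual_scale p r (0 : V * V) = 0.
Proof. by rewrite /dual_scale /= !scaler0 addr0. Qed.

(** Symmetry comes from commuting a(1) with b(-1) on the vacuum, invariance from commuting b(0) with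
    a(1) on [gamma c]. By Schur's lemma [q] is then a multiple c of [form], which is the level K + c
    t. *)
Lemma level_invariant : invariant_symmetric_form q.
Proof.
have scaleD p1 q1 p2 q2 c : c *: dual_scale p1 q1 one + dual_scale p2 q2 one =
    dual_scale (c * p1 + p2) (c * q1 + q2) one.
  rewrite /dual_scale /= !scaler0 !add0r.
  by rewrite !scalerDl -!scalerA.
have qC a b : q a b = q b a.
  have H := gamma_comm a b 1 (-1) one; have H' := gamma_comm b a (-1) 1 one.
  have := congr2 +%R H H'; rewrite addrA subrK subrr.
  rewrite !(dualY_creation dY _).1 // !add0r scale1r /= scaleN1r => /eqP.
  by rewrite eq_sym subr_eq0 => /eqP/dual_scale_one_inj[_ ->].
have qlin b : linear (fun a => q a b : C^o).
  move=> c x y; have := qE (c *: x + y) b.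
  rewrite gamma_linear (vo_bilinear voW 1).2 !qE scaleD.
  by move=> /dual_scale_one_inj[_ <-].
split=> // [|a b c].
  split=> // a x u v; rewrite !(qC a); exact: qlin.
have := gamma_comm b a 0 1 (gamma c).
rewrite !gammaE !qE dualY_scale (dualY_creation dY _).1 // dual_scale0 add0r /= addr0.
have qN x y : q (- x) y = - q x y by exact: linear_funN (qlin y) x.
rewrite -[LHS]scaleN1r -[_ *: _]addr0; have -> : 0 = dual_scale 0 0 one.
  by rewrite /dual_scale /= !scale0r addr0.
rewrite scaleD => /dual_scale_one_inj[_]; rewrite addr0 mulN1r (lieC b a) qN.
by move=> /oppr_inj ->.
Qed.

Notation X m := (iter m (fun z => DY (gamma e) (-1) z) one).

Lemma dual_annihilated : annihilated (fun a n z => DY (gamma a) n z) one.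
Proof. by move=> a n n0; exact: (dualY_creation dY _).1. Qed.

Lemma dual_power_fst m z :
  (iter m (fun z => DY (gamma e) (-1) z) z).1 = iter m (modes iota e (-1)) z.1.
Proof. by elim: m => //= m ->. Qed.

Lemma dual_power_snd m v :
  iter m (fun z => DY (gamma e) (-1) z) (0, v) = (0, iter m (modes iota e (-1)) v).
Proof.
elim: m => //= m ->; rewrite /dualY /= (Y10r dY) !(vo0r voY) !addr0 //.
Qed.

(** The (K + 1)-st power vanishes modulo t, so it lies in t V, where e(-1) acts as on V and is
    locally nilpotent. *)
Lemma dual_power_nilpotent : exists m, X m = 0.
Proof.
have XK : iter K.+1 (modes iota e (-1)) (vac V) = 0.
  apply: rad; exact: (affine_power_radical iota1 aff ann form_is extremal).
have [n Xn] := affine_power_locally_nilpotent gen aff form_is extremal XK (X K.+1).2.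
exists (n + K.+1)%N; rewrite iterD.
have -> : X K.+1 = (0, (X K.+1).2) by rewrite -XK -(dual_power_fst _ one); case: (X K.+1).
by rewrite dual_power_snd Xn.
Qed.

(** The coefficient is the dual number (m + 1)(K + c t - m), as in [affine_mode1_power] at level K +
    c t. *)
Lemma dual_mode1_power c m : (forall a b, q a b = c * form a b) ->
  DY (gamma f) 1 (X m.+1) = dual_scale (m.+1%:R * (K%:R - m%:R)) (m.+1%:R * c) (X m).
Proof.
move=> qc.
have -> := mode1_power gamma_bilinear gamma_comm (e := e)
  (fun a b n w => esym (dualY_scale _ _ _ _ _)) dual_annihilated m (extremal f).
have binE : 2 * 'C(m.+1, 2)%:R = m.+1%:R * m%:R :> C.
  by rewrite -!natrM -(mul_bin_diag m.+1 1) bin1.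
rewrite (formC form_is e) form_fe mulr1 mulNr binE qc form_fe mulr1 mul1r.
rewrite /dual_scale; case: (X m) => x y; congr pair => /=.
  by rewrite scalerA -scalerDl mulrBr.
by rewrite scalerDr !scalerA addrAC -scalerDl mulrBr.
Qed.

(* As K - m + c t is invertible for m > K, a vanishing power of e(-1) on the vacuum
   forces the (K + 1)-st one to vanish; applying f(1) to the latter gives c = 0. *)
Lemma level_rigid a b : q a b = 0.
Proof.
have form0 : exists x y, form x y <> 0.
  by exists f, e; rewrite form_fe; apply/eqP; exact: oner_neq0.
have [c qc] := form_proportional gs form_is form0 level_invariant.
suff c0 : c = 0 by rewrite qc c0 mul0r.
have act0 n x : DY x n (0 : V * V) = 0 by exact: vo0r voW _ _.
have down m : X m.+1 = 0 -> dual_scale (m.+1%:R * (K%:R - m%:R)) (m.+1%:R * c) (X m) = 0.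
  by move=> Xm; rewrite -(dual_mode1_power m qc) Xm act0.
have [m Xm] := dual_power_nilpotent.
have neq0 i : (i <= K)%N -> X i <> 0.
  move=> iK Xi; apply: (affine_power_neq0 aff ann form_is extremal vac0 erefl form_fe iK).
  by rewrite -(dual_power_fst _ one) Xi.
have mK : (K < m)%N by rewrite ltnNge; apply/negP => /neq0.
(* Beyond K the constant part of the coefficient is non-zero, so [down] kills the constant part of
   the lower power and then its t-part. *)
have XK : X K.+1 = 0.
  rewrite -(subnKC mK) in Xm; elim: (m - K.+1)%N Xm => [|i IH]; first by rewrite addn0.
  rewrite addnS => /down; case: (X _) IH => x y IH [/eqP].
  rewrite scaler_eq0 mulf_eq0 pnatr_eq0 /= subr_eq0 eqr_nat.
  rewrite [K == _]eqn_leq andbC leqNgt (leq_trans (ltnSn K)) ?leq_addr //=.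
  move=> /eqP x0; rewrite x0 scaler0 addr0 => /eqP.
  rewrite scaler_eq0 mulf_eq0 pnatr_eq0 /= subr_eq0 eqr_nat.
  rewrite [K == _]eqn_leq andbC leqNgt (leq_trans (ltnSn K)) ?leq_addr //=.
  by move=> /eqP y0; apply: IH; rewrite x0 y0.
have := congr1 snd (down K XK); rewrite /dual_scale /= subrr mulr0 scale0r add0r => /eqP.
rewrite scaler_eq0 mulf_eq0 pnatr_eq0 /= => /orP[/eqP //|/eqP XK1].
have := affine_power_neq0 aff ann form_is extremal vac0 erefl form_fe (leqnn K).
by rewrite -(dual_power_fst _ one) XK1.
Qed.

Lemma gamma_affine_module :
  affine_module form K%:R (fun a n (z : V * V) => DY (gamma a) n z).
Proof.
split=> [|a b m n z]; first exact: gamma_bilinear.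
rewrite gamma_comm level_rigid; congr (_ + _); case: ifP => _; last by rewrite scale0r.
by rewrite -mulrA -scalerA /dual_scale scale0r addr0; case: z.
Qed.

End Rigidity.

(** * The lift to V[t]/(t^2) and the trivializing map *)

Section Triviality.
Variables (C : numFieldType) (g : lieAlgebra C) (form : g -> g -> C) (k : C).
Variables (U V : vertexAlgebra C) (iota : g -> U) (pi : U -> V).
Hypotheses (iota_lin : linear iota) (univ : universal_affine form k iota).
Hypothesis quo : simple_quotient pi.
Variable Y1 : V -> int -> V -> V.
Hypothesis dY : first_order_deformation Y1.
Notation DY := (dualY Y1).
Notation one := (dual_one V).
Variable gamma2 : g -> V.
Hypothesis gamma2_hom : forall a, hom V 1 (gamma2 a).
Notation gamma a := ((quo_iota iota pi a, gamma2 a) : V * V).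
Hypothesis gamma_affine : affine_module form k (fun a n (z : V * V) => DY (gamma a) n z).
Let voY := va_vertex_operator V.
Let voW := dualY_vertex_operator dY.
Let pi_lin := quotient_linear quo.
Let genU := universal_generated univ.
Let genV := quo_generated univ quo.

Lemma def_mode_component (u v : V) p m n : hom V p u ->
  component m (Y1 u n v) = Y1 u n (component (m + n + 1 - p) v).
Proof.
have [_ Yw _ _ _] := dY.
move=> up; rewrite -(@component_shift _ _ _ (Y1 u n) (p - n - 1)).
- by congr component; ring.
- exact: (def_bilinear dY n).1.
by move=> q w wq; rewrite addrC; apply: Yw.
Qed.

(** This is the t-part of the map given by the universal property, whose constant part is [pi]. The
    universal property is silent on the grading, so gradedness is proved by induction on
    generation. *)
Lemma lift_exists : exists F : U -> V,
  [/\ linear F, F (vac U) = 0, forall n v, component n (F v) = F (component n v) &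
  forall a n v, F (Y (iota a) n v) =
    Y (quo_iota iota pi a) n (F v) + Y (gamma2 a) n (pi v) + Y1 (quo_iota iota pi a) n (pi v)].
Proof.
have [_ _ _ lift] := univ.
have ann : annihilated (fun a n (z : V * V) => DY (gamma a) n z) one.
  by move=> a n n0; exact: (dualY_creation dY _).1.
have [F [Fl F1 Fa]] := lift _ _ _ gamma_affine ann.
have Ffst v : (F v).1 = pi v.
  move: v; apply: genU => [||a n v n0 Fv].
  - split=> [|a u v Fu Fv]; first by rewrite (linear_fun0 Fl) (linear_fun0 pi_lin).
    by rewrite Fl pi_lin /= Fu Fv.
  - by rewrite F1 (quotient_vac quo).
  by rewrite -/(modes iota a _ v) Fa /= Fv (quotient_Y quo).
pose F2 v := (F v).2.
have F2l : linear F2 by move=> a u v; rewrite /F2 Fl.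
have F2a a n v : F2 (Y (iota a) n v) =
    Y (quo_iota iota pi a) n (F2 v) + Y (gamma2 a) n (pi v) + Y1 (quo_iota iota pi a) n (pi v).
  by rewrite /F2 -/(modes iota a n v) Fa /= Ffst.
have F21 : F2 (vac U) = 0 by rewrite /F2 F1.
exists F2; split=> // n v; move: v n; apply: genU => [||a m v m0 Fv].
- split=> [n|a u v Fu Fv n].
    by rewrite component0 (linear_fun0 F2l) component0.
  by rewrite F2l !componentD !componentZ F2l Fu Fv.
- move=> n; rewrite F21 component0; have vU := va_vacuum_weight U.
  have [<-|n0] := eqVneq 0 n; first by rewrite component_id.
  by rewrite (component_neq vU n0) (linear_fun0 F2l).
have q1 := quo_iota_hom univ quo a; move=> n.
rewrite (mode_component _ _ _ (universal_iota_hom univ a)) !F2a !componentD.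
rewrite (mode_component _ _ _ q1) (mode_component _ _ _ (gamma2_hom a)).
by rewrite (def_mode_component _ _ _ q1) Fv !(quotient_component quo).
Qed.

(* Such a lift F of V^k(g) kills the kernel I of pi: F(I) is stable under the modes
   of g, and contains no vacuum since I and F are graded. *)
Lemma lift_descends F : linear F -> F (vac U) = 0 ->
  (forall n v, component n (F v) = F (component n v)) ->
  (forall a n v, F (Y (iota a) n v) =
    Y (quo_iota iota pi a) n (F v) + Y (gamma2 a) n (pi v) + Y1 (quo_iota iota pi a) n (pi v)) ->
  forall v, pi v = 0 -> F v = 0.
Proof.
move=> Fl F1 Fc Fa v pv; apply: (quo_radical_eq0 iota_lin univ quo) => s.
suff [w [pw <-]] : exists w, pi w = 0 /\ F w = mode_word (quo_iota iota pi) s (F v).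
  rewrite Fc; have [_ [c ->] _] := low_weights genU iota_lin (universal_iota_hom univ) w.
  by rewrite (linear_funZ Fl) F1 scaler0.
elim: s => [|[a n] s [w [pw Fw]]] /=; first by exists v.
exists (Y (iota a) n w); rewrite (quotient_Y quo) pw (vo0r voY); split=> //.
by rewrite Fa pw (vo0r voY) (Y10r dY) !addr0 Fw.
Qed.

Lemma deformation_trivial : trivial_deformation Y1.
Proof.
have [F [Fl F1 Fc Fa]] := lift_exists; have Fker := lift_descends Fl F1 Fc Fa.
pose s w := sval (cid (quotient_surj quo w)).
have sK w : pi (s w) = w by rewrite /s; case: cid.
pose G w := F (s w).
have Gpi v : G (pi v) = F v.
  apply/eqP; rewrite -subr_eq0 -(linear_funB Fl); apply/eqP/Fker.
  by rewrite (linear_funB pi_lin) sK subrr.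
have Gl : linear G.
  by move=> a u v; rewrite -[u]sK -[v]sK -pi_lin !Gpi Fl.
have Ga a n w : G (Y (quo_iota iota pi a) n w) =
    Y (quo_iota iota pi a) n (G w) + Y (gamma2 a) n w + Y1 (quo_iota iota pi a) n w.
  by rewrite -[w]sK -(quotient_Y quo) !Gpi Fa.
have Giota a : G (quo_iota iota pi a) = gamma2 a.
  have [_ _ Yv _ _] := dY.
  rewrite -[quo_iota iota pi a](va_creation _).2 Ga -(quotient_vac quo) Gpi F1 (vo0r voY).
  by rewrite (quotient_vac quo) (va_creation _).2 (Yv _ _).2 add0r addr0.
have Gvac : G (vac V) = 0 by rewrite -(quotient_vac quo) Gpi.
pose H w : V * V := (w, G w).
have Hl : linear H by move=> a u v; rewrite /H Gl.
have Hmode a n w : H (Y (quo_iota iota pi a) n w) = DY (gamma a) n (H w).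
  by rewrite /H Ga.
(* [H] is the section w + t G(w) of the projection from W to V. It respects the modes of g, and the
   iterate formula extends this to all vertex operators; the t-part then gives the trivialization
   with phi = - G. *)
have HY u n w : H (Y u n w) = DY (H u) n (H w).
  move: n w; move: u; apply: genV => [||a m u m0 Hu n w].
  - split=> [n w|a u v Hu Hv n w].
      by rewrite (vo0l voY) !(linear_fun0 Hl) (vo0l voW).
    by rewrite (voDl voY) (voZl voY) !Hl Hu Hv (voDl voW) (voZl voW).
  - move=> n w; have -> : H (vac V) = dual_scale 1 0 one.
      by rewrite /H Gvac /dual_scale /= scale1r scaler0 scale0r addr0.
    rewrite (dualY_scale_one dY) va_vacuum; case: ifP => _; last exact: linear_fun0.
    by rewrite /dual_scale /= !scale1r scale0r addr0.
  have [N1 H1] := vo_iterate voY (quo_iota iota pi a) u w (- m%:Z) n.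
  have [N2 H2] := vo_iterate voW (gamma a) (H u) (H w) (- m%:Z) n.
  rewrite Hmode (H1 (N1 + N2)%N) ?leq_addr // (H2 (N1 + N2)%N) ?leq_addl //.
  rewrite (linear_funB Hl) !(linear_fun_sum Hl); congr (_ - _); apply: eq_bigr => i _.
    by rewrite (linear_funZ Hl) Hmode Hu.
  by rewrite (linear_funZ Hl) Hu Hmode.
exists (fun w => - G w); split=> [a u v|n w wn||u n w].
- by rewrite Gl opprD scalerN.
- rewrite -scaleN1r; apply: homZ.
  suff <- : component n (G w) = G w by exact: component_hom.
  by rewrite /G Fc -Gpi -(quotient_component quo) sK (component_id wn).
- by rewrite Gvac oppr0.
have := congr1 snd (HY u n w); rewrite /= => ->.
rewrite (voNl voY) (voNr voY) opprK [RHS](AC (1*3*1) (1*3*(2*5)*4)) /=.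
by rewrite addNr subrr !add0r.
Qed.

End Triviality.

Theorem theorem4p1 (R : realType) (g : lieAlgebra R[i])
    (form : g -> g -> R[i]) (k : nat) (V : vertexAlgebra R[i]) :
  simple_lie g -> normalized_form form -> (0 < k)%N ->
  simple_affine form (k%:R : R[i]) V ->
  forall Y1 : V -> int -> V -> V,
    first_order_deformation Y1 -> trivial_deformation Y1.
Proof.
move=> gs norm k0 [U [iota [pi [iota_lin univ quo]]]] Y1 dY.
have [form_is _] := norm.
have [K0 [e [f [ef ext]]]] := normalized_extremal_vector gs norm.
have gen := quo_generated univ quo; have lin := quo_iota_linear iota_lin quo.
have hom1 := quo_iota_hom univ quo; have aff := quo_affine_module iota_lin univ quo.
have ann := quo_annihilated univ quo; have v0 := quotient_vac_neq0 quo.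
have rad := quo_radical_eq0 iota_lin univ quo.
have fe : form f e = 1 by rewrite (formC form_is).
have [phi phil gammaE] := dual_iota_corrected gen lin hom1 aff ann v0 k0 gs K0 form_is fe ext dY.
have [q qE] := level_exists gen lin hom1 aff v0 dY phi.
apply: (deformation_trivial iota_lin univ quo dY (gamma2 := fun a => quo_iota iota pi (phi a))).
  by move=> a; exact: hom1.
exact: (gamma_affine_module gen lin hom1 aff ann v0 rad gs form_is fe ext dY phil gammaE qE).
Qed.
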